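(* Let $\mathrm{X}=(X_n)_{n\ge1}$ be a sequence of random variables in $\mathbb{T}$, each distributed according to Lebesgue measure, and let $\mathrm{r}=(r_n)_{n\ge1}$ be a sequence of reals in $(0,1]$. Let $G$ be a nonempty compact subset of $\mathbb{T}$ and $g$ a gauge function with $\mathcal{H}^g(G)>0$. Then for any gauge functions $h$ and $\varphi$ with $h\prec_\varphi g$: if $\Theta(\mathrm{X},\mathcal{B}(\mathrm{r}))<\infty$ and $\sum_n r_n/\varphi(r_n)=\infty$, then almost surely $\mathcal{H}^h(\mathcal{E}(\mathrm{X},\mathrm{r})\cap G)>0$.
   Context: $\mathbb{T}=\mathbb{R}/\mathbb{Z}$ with quotient distance $d$. $\mathcal{E}(\mathrm{X},\mathrm{r})=\{\xi\in\mathbb{T}: d(\xi,X_n)<r_n\text{ for infinitely many }n\}$. A gauge function is a nondecreasing right-continuous function on $[0,\infty)$ vanishing at zero and only at zero; $\mathcal{H}^g$ is the Hausdorff $g$-measure. For a sequence $\mathrm{B}=(B_n)$ of Borel subsets of $\mathbb{T}$ of positive Lebesgue measure, $\theta(\mathrm{X},\mathrm{B})=\sup_{n\ge1}\frac{\mathbb{P}(X_1\in B_1,\dots,X_n\in B_n)}{\prod_{i=1}^n\mathbb{P}(X_i\in B_i)}$ and $\Theta(\mathrm{X},\mathcal{B})=\sup_{\mathrm{B}\in\mathcal{B}}\theta(\mathrm{X},\mathrm{B})$. With $q_n=\lceil1/r_n\rceil$ and $I_{n,k}$ the image of $[k/q_n,(k+1)/q_n)$ in $\mathbb{T}$, $\mathcal{B}(\mathrm{r})$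 is the collection of all sequences $(I_{n,k_n})_{n\ge1}$ with $0\le k_n<q_n$. For gauge functions $g,h,\varphi$, one writes $h\prec_\varphi g$ if $g/h$ monotonically tends to zero at the origin and $\sum_{j=1}^\infty\frac{g(2^{-j})}{h(2^{-j})}\left(\frac{1}{\varphi(2^{-j})}-\frac{1}{\varphi(2^{-(j-1)})}\right)<\infty$. *)

(* Defs.v *)
From HB Require Import structures.
From mathcomp Require Import all_boot all_order all_algebra.
From mathcomp Require Import all_classical all_reals all_analysis.
Set Implicit Arguments. Unset Strict Implicit. Unset Printing Implicit Defensive.
Import Order.TTheory GRing.Theory Num.Theory.
Import numFieldNormedType.Exports.
Local Open Scope classical_set_scope.
Local Open Scope ring_scope.

Section Torus.
Variable R : realType.

(* The torus T = R/Z is represented by the fundamental domain [0,1). *)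
Definition torus : set R := `[0, 1[%classic.

Definition tfrac (x : R) : R := x - (Num.floor x)%:~R.

Definition tdist (x y : R) : R :=
  Num.min (tfrac (x - y)) (1 - tfrac (x - y)).

(* diameter w.r.t. the quotient distance (sup set0 = 0 by convention) *)
Definition tdiam (U : set R) : R := sup [set tdist x y | x in U & y in U].

Definition gauge (g : R -> R) : Prop :=
  {in `[0, +oo[ &, {homo g : x y / x <= y}} /\
  (forall a, 0 <= a -> g t @[t --> a^'+] --> g a) /\
  g 0 = 0 /\ (forall x, 0 < x -> 0 < g x).

Definition hcontent (g : R -> R) (delta : R) (A : set R) : \bar R :=
  ereal_inf [set (\sum_(0 <= i <oo) (g (tdiam (U i)))%:E)%E |
     U in [set U : nat -> set R | (forall i, U i `<=` torus) /\
                                  (forall i, tdiam (U i) <= delta) /\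
                                  A `<=` \bigcup_i U i]].

(* Hausdorff g-measure: limit (= supremum) as delta -> 0+ *)
Definition hausdorff (g : R -> R) (A : set R) : \bar R :=
  ereal_sup [set hcontent g delta A | delta in `]0, +oo[%classic].

Definition gauge_prec (phi h g : R -> R) : Prop :=
  (exists2 eps : R, 0 < eps &
     {in `]0, eps] &, {homo (fun t => g t / h t) : x y / x <= y}}) /\
  (g t / h t @[t --> 0^'+] --> 0) /\
  (\sum_(1 <= j <oo)
     ((g (2 ^- j) / h (2 ^- j)) *
      ((phi (2 ^- j))^-1 - (phi (2 ^- j.-1))^-1))%:E < +oo)%E.

Definition limsup_set (Omega : Type) (X : nat -> Omega -> R) (r : nat -> R)
    (w : Omega) : set R :=
  [set xi | torus xi /\ forall N, exists2 n, (N <= n)%N & tdist xi (X n w) < r n].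

Definition qn (r : nat -> R) (n : nat) : nat := `|Num.ceil (r n)^-1|%N.

Definition Ik (q k : nat) : set R :=
  [set x | k%:R / q%:R <= x < k.+1%:R / q%:R].

Section Theta.
Context d (Omega : measurableType d) (P : probability Omega R).

Definition theta (X : nat -> Omega -> R) (B : nat -> set R) : \bar R :=
  ereal_sup [set (fine (P [set w | forall i, (i <= n)%N -> B i (X i w)]) /
                  \prod_(i < n.+1) fine (P (X i @^-1` B i)))%:E | n in [set: nat]].

Definition Theta_r (X : nat -> Omega -> R) (r : nat -> R) : \bar R :=
  ereal_sup [set theta X (fun n => Ik (qn r n) (k n)) |
             k in [set k : nat -> nat | forall n, (k n < qn r n)%N]].
End Theta.
End Torus.
Arguments torus {R}.

(* Main.v *)
(** Let K_n be the index of the cell of length 1/q_n that contains X_n.  Finiteness of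
    Theta says that the law of (K_n) on every finite block of indices is at most a constant
    times the uniform product law, so events that are rare under independence remain rare.
    Moreover E(X, r) contains the limsup of the cells I_n of index K_n.

    The summability condition in [gauge_prec] is only used through the bound
    g <= A h phi at dyadic scales, besides the monotone decay of g / h.

    Let m be a finite measure (here a finite sum of point masses) with m(D) <= min(h, B g)
    on dyadic cells D.  On a block of indices put f = (1/S) sum_n 1_(I_n) / phi(1/q_n), with S
    normalizing the mean of f to 1; S is large for long blocks.  Up to small m-mass, f m
    satisfies the same bound for h.  For the finitely many coarse cells this is Chebyshev's
    inequality.  For a fine cell D, the I_n larger than D are controlled pointwise by a first
    moment, size-biased by f, of sum_n (g/h)(1/q_n) 1_(I_n) / (S phi(1/q_n)); the I_n smaller
    than D are controlled by a variance, and one only needs to look at those levels where h has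
    dropped by a factor 2.  Thus the h-content of a compact set C is almost preserved by passing
    to C intersected with the union of the I_n over a block.  By induction one gets a
    decreasing sequence of compact sets with h-contents bounded below whose intersection lies
    in E(X, r) and G, up to countably many endpoints; compactness bounds the h-content of the
    intersection.  At each step the set C ranges over a countable family, so a null set can be
    discarded for each of its members. *)
Require Import Defs.
From HB Require Import structures.
From mathcomp Require Import all_boot all_order all_algebra.
From mathcomp Require Import all_classical all_reals all_analysis.
From mathcomp Require Import ring lra zify.
Import Order.TTheory GRing.Theory Num.Theory.
Import numFieldNormedType.Exports.
Set Implicit Arguments.
Unset Strict Implicit.
Unset Printing Implicit Defensive.
Local Open Scope classical_set_scope.
Local Open Scope ring_scope.

(** * Expectations under finite product laws *)

Section ProductExpectation.
Variables (R : realType) (I T : finType) (p : I -> T -> R).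
Hypothesis p_ge0 : forall i k, 0 <= p i k.
Hypothesis p_sum1 : forall i, \sum_k p i k = 1.

Definition pmass (c : {ffun I -> T}) : R := \prod_i p i (c i).

Definition pexp (F : {ffun I -> T} -> R) : R := \sum_c pmass c * F c.

Lemma pmass_ge0 c : 0 <= pmass c.
Proof. by apply: prodr_ge0 => i _. Qed.

Lemma pexpD F G : pexp (fun c => F c + G c) = pexp F + pexp G.
Proof. by rewrite -big_split; apply: eq_bigr => c _; rewrite mulrDr. Qed.

Lemma pexpZ a F : pexp (fun c => a * F c) = a * pexp F.
Proof. by rewrite mulr_sumr; apply: eq_bigr => c _; rewrite mulrCA. Qed.

Lemma pexp_sum (J : Type) (s : seq J) (P : pred J) (F : J -> {ffun I -> T} -> R) :
  pexp (fun c => \sum_(j <- s | P j) F j c) = \sum_(j <- s | P j) pexp (F j).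
Proof.
rewrite /pexp; under eq_bigr => c _ do rewrite mulr_sumr.
exact: exchange_big.
Qed.

Lemma eq_pexp F G : F =1 G -> pexp F = pexp G.
Proof. by move=> FG; apply: eq_bigr => c _; rewrite FG. Qed.

(** Independence in its basic form: a product of sums over outcomes expands into a sum over all
    outcome functions. *)
Lemma pexp_prod (u : I -> T -> R) :
  pexp (fun c => \prod_i u i (c i)) = \prod_i \sum_k p i k * u i k.
Proof.
by rewrite bigA_distr_bigA /=; apply: eq_bigr => c _; rewrite big_split.
Qed.

Definition emean (i : I) (u : T -> R) : R := \sum_k p i k * u k.

Lemma pexp1 i u : pexp (fun c => u (c i)) = emean i u.
Proof.
have -> : pexp (fun c => u (c i)) =
    pexp (fun c => \prod_j (if j == i then u (c j) else 1)).
  by apply: eq_pexp => c; rewrite -big_mkcond big_pred1_eq.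
rewrite (pexp_prod (fun j k => if j == i then u k else 1)) (bigD1 i) //= eqxx.
rewrite [X in _ * X]big1 ?mulr1 // => j /negPf ->.
by under eq_bigr do rewrite mulr1; exact: p_sum1.
Qed.

Lemma pexp2 i j u v : i != j ->
  pexp (fun c => u (c i) * v (c j)) = emean i u * emean j v.
Proof.
move=> ij; have /negPf ji : j != i by rewrite eq_sym.
have -> : pexp (fun c => u (c i) * v (c j)) =
    pexp (fun c => \prod_l (if l == i then u (c l) else
                            if l == j then v (c l) else 1)).
  apply: eq_pexp => c; rewrite (bigD1 i) //= eqxx (bigD1 j) ?ji //=.
  rewrite eqxx big1 ?mulr1 // => l /andP[/negPf -> /negPf ->] //.
rewrite (pexp_prod (fun l k => if l == i then u k else if l == j then v k else 1)).
rewrite (bigD1 i) //= eqxx (bigD1 j) ?ji //= eqxx.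
rewrite [X in _ * (_ * X)]big1 ?mulr1 // => l /andP[/negPf -> /negPf ->].
by under eq_bigr do rewrite mulr1; exact: p_sum1.
Qed.

(** By independence the cross terms factor into products of means, so only the diagonal terms need a
    correction. *)
Lemma pexp_mul_sum (u v : I -> T -> R) :
  pexp (fun c => (\sum_i u i (c i)) * (\sum_i v i (c i))) =
  (\sum_i emean i (u i)) * (\sum_i emean i (v i)) +
  \sum_i (emean i (fun k => u i k * v i k) - emean i (u i) * emean i (v i)).
Proof.
under eq_pexp => c do rewrite big_distrlr /=.
rewrite pexp_sum big_distrlr /= -big_split /=; apply: eq_bigr => i _.
rewrite pexp_sum (bigD1 i) //= (pexp1 i (fun k => u i k * v i k)).
rewrite [in RHS](bigD1 i) //=.
rewrite (eq_bigr (fun j => emean i (u i) * emean j (v j))); first by ring.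
by move=> j ji; rewrite pexp2 // eq_sym.
Qed.

(** Variances of independent terms add up, and each variance is at most the second moment. *)
Lemma pexp_variance_le (u : I -> T -> R) :
  pexp (fun c => (\sum_i u i (c i) - \sum_i emean i (u i)) ^+ 2) <=
  \sum_i emean i (fun k => u i k ^+ 2).
Proof.
set v := fun i k => u i k - emean i (u i).
have v0 i : emean i (v i) = 0.
  rewrite /emean; under eq_bigr do rewrite mulrBr.
  by rewrite sumrB -mulr_suml p_sum1 mul1r subrr.
under eq_pexp => c do rewrite -sumrB expr2.
rewrite (pexp_mul_sum v v) [X in X * _]big1 // mul0r add0r.
apply: ler_sum => i _; rewrite v0 mul0r subr0.
have -> : emean i (fun k => v i k * v i k) =
    emean i (fun k => u i k ^+ 2) - emean i (u i) ^+ 2.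
  rewrite {1}/emean (eq_bigr (fun k => p i k * u i k ^+ 2 -
    2 * emean i (u i) * (p i k * u i k) + emean i (u i) ^+ 2 * p i k)); last first.
    by move=> k _; rewrite /v; ring.
  by rewrite big_split sumrB /= -!mulr_sumr p_sum1 -/(emean i (u i)) /emean; ring.
by rewrite gerBl sqr_ge0.
Qed.

Lemma pexp_mul_le (u v : I -> T -> R) :
  (forall i k, 0 <= u i k) -> (forall i k, 0 <= v i k) ->
  pexp (fun c => (\sum_i u i (c i)) * (\sum_i v i (c i))) <=
  (\sum_i emean i (u i)) * (\sum_i emean i (v i)) +
  \sum_i emean i (fun k => u i k * v i k).
Proof.
move=> u0 v0; rewrite pexp_mul_sum lerD2l; apply: ler_sum => i _.
by rewrite gerBl mulr_ge0 // sumr_ge0 // => k _; rewrite mulr_ge0.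
Qed.

Lemma pexp_markov (F : {ffun I -> T} -> R) a : (forall c, 0 <= F c) -> 0 < a ->
  \sum_(c | a < F c) pmass c <= pexp F / a.
Proof.
move=> F0 a0; rewrite ler_pdivlMr // mulr_suml /pexp.
rewrite [leRHS](bigID (fun c => a < F c)) /= ler_wpDr //.
  by apply: sumr_ge0 => c _; rewrite mulr_ge0 ?pmass_ge0.
by apply: ler_sum => c /ltW; apply: ler_wpM2l; exact: pmass_ge0.
Qed.

End ProductExpectation.
(** * Cells and point masses *)

Section Cells.
Variable R : realType.
Implicit Types (x : R) (q k : nat).

Lemma in_Ik q k x : (0 < q)%N -> Ik q k x <-> k%:R <= q%:R * x < k.+1%:R.
Proof.
by move=> q0; rewrite /Ik /= ler_pdivrMr ?ltr0n // ltr_pdivlMr ?ltr0n // (mulrC x).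
Qed.

Lemma Ik_inj q k k' x : (0 < q)%N -> Ik q k x -> Ik q k' x -> k = k'.
Proof.
move=> q0 /(in_Ik _ _ q0)/andP[a b] /(in_Ik _ _ q0)/andP[c d].
have := le_lt_trans a d; have := le_lt_trans c b; rewrite !ltr_nat.
by lia.
Qed.

Lemma Ik_exists q x : (0 < q)%N -> torus x -> exists2 k, (k < q)%N & Ik q k x.
Proof.
move=> q0; rewrite /torus /= in_itv /= => /andP[x0 x1].
have qx : 0 <= q%:R * x by rewrite mulr_ge0.
have /andP[ta tb] := truncn_itv qx.
exists (Num.truncn (q%:R * x)); last by apply/in_Ik => //; apply/andP.
rewrite -(ltr_nat R); apply: (le_lt_trans ta).
by rewrite -[ltRHS]mulr1 ltr_pM2l ?ltr0n.
Qed.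

Lemma Ik_torus q k : (k < q)%N -> Ik q k `<=` (torus : set R).
Proof.
move=> kq x; have q0 : (0 < q)%N by lia.
rewrite /Ik /torus /= in_itv /= => /andP[a b]; apply/andP; split.
  by apply: le_trans a; rewrite divr_ge0.
by apply: (lt_le_trans b); rewrite ler_pdivrMr ?ltr0n // mul1r ler_nat.
Qed.

Lemma Ik_lt q k x : torus x -> Ik q k x -> (k < q)%N.
Proof.
rewrite /torus /= in_itv /= => /andP[x0 x1] xk.
(* For [q = 0] both endpoints of the cell are 0, since the inverse of 0 is 0, and the cell is
   empty. *)
have [q0|] := posnP q; first by move: xk; rewrite /Ik /= q0 invr0 !mulr0 ltNge x0 andbF.
move=> q0; move/(in_Ik _ _ q0): xk => /andP[a _].
rewrite -(ltr_nat R); apply: (le_lt_trans a).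
by rewrite -[ltRHS]mulr1 ltr_pM2l ?ltr0n.
Qed.

Lemma Ik_mul q m k : (0 < q)%N -> (0 < m)%N -> Ik (q * m) k `<=` (Ik q (k %/ m) : set R).
Proof.
move=> q0 m0 x; have qm0 : (0 < q * m)%N by rewrite muln_gt0 q0.
move=> /(in_Ik _ _ qm0)/andP[a b].
apply/in_Ik => //; move: a b; rewrite natrM (mulrC q%:R) -mulrA => a b.
have m0R : 0 < m%:R :> R by rewrite ltr0n.
apply/andP; split.
  rewrite -(ler_pM2l m0R); apply: le_trans a.
  by rewrite -natrM ler_nat mulnC leq_divM.
rewrite -(ltr_pM2l m0R); apply: (lt_le_trans b).
by rewrite -natrM ler_nat mulnC ltn_ceil.
Qed.

Lemma Ik_pow2 i j k : (i <= j)%N -> Ik (2 ^ j) k `<=` (Ik (2 ^ i) (k %/ 2 ^ (j - i)) : set R).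
Proof.
by move=> ij; rewrite -{1}(subnKC ij) expnD; apply: Ik_mul; rewrite expn_gt0.
Qed.

Lemma Ik_pow2_split j k x : Ik (2 ^ j) k x ->
  Ik (2 ^ j.+1) k.*2 x \/ Ik (2 ^ j.+1) k.*2.+1 x.
Proof.
have p0 i : (0 < 2 ^ i)%N by rewrite expn_gt0.
move=> /(in_Ik _ _ (p0 _))/andP[a b].
have E : (2 ^ j.+1)%:R * x = 2 * ((2 ^ j)%:R * x) by rewrite expnS natrM mulrA.
have [le|lt] := lerP (k.*2.+1)%:R ((2 ^ j.+1)%:R * x); [right|left].
  apply/in_Ik => //; rewrite le /= E -doubleS -muln2 natrM; lra.
apply/in_Ik => //; rewrite lt andbT E -muln2 natrM; lra.
Qed.

Lemma Ik_near q k x y : Ik q k x -> Ik q k y -> `|x - y| < q%:R^-1.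
Proof.
rewrite /Ik /= -[k.+1]addn1 natrD mulrDl mul1r => /andP[a b] /andP[c d].
by rewrite ltr_norml; lra.
Qed.

End Cells.

(** * Finite measures as lists of weighted points *)

Section PointMasses.
Variable R : realType.
Implicit Types (x : R) (s : seq (R * R)) (A : set R).

Definition mass s A : R := \sum_(z <- s | z.1 \in A) z.2.

Definition pos_mass s := forall z, z \in s -> 0 <= z.2.

Lemma mass_ge0 s A : pos_mass s -> 0 <= mass s A.
Proof. by move=> s0; rewrite /mass big_seq_cond sumr_ge0 // => z /andP[/s0]. Qed.

Lemma le_mass s A B : pos_mass s -> (forall z, z \in s -> A z.1 -> B z.1) ->
  mass s A <= mass s B.
Proof.
move=> s0 AB; rewrite /mass big_mkcond [leRHS]big_mkcond big_seq [leRHS]big_seq.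
apply: ler_sum => z zs.
have [/set_mem /(AB _ zs) /mem_set ->//|_] := boolP (z.1 \in A).
by case: ifP => // _; exact: s0.
Qed.

Lemma mass0 s A : (forall z, z \in s -> ~ A z.1) -> mass s A = 0.
Proof.
move=> sA; rewrite /mass big_seq_cond big1 // => z /andP[zs].
by rewrite inE => /(sA _ zs).
Qed.

Lemma mass_cat s1 s2 A : mass (s1 ++ s2) A = mass s1 A + mass s2 A.
Proof. exact: big_cat. Qed.

Definition scale_mass (l : R) s := [seq (z.1, l * z.2) | z <- s].

Lemma mass_scale l s A : mass (scale_mass l s) A = l * mass s A.
Proof. by rewrite /mass big_map mulr_sumr. Qed.

(** The range may exceed [q] because the outcomes of all indices of a block will share one type;
    cells with index at least [q] do not meet [0,1). *)
Lemma mass_sum_cells s A q n : (0 < q)%N -> (forall z, z \in s -> torus z.1) ->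
  (q <= n)%N -> \sum_(k < n) mass s (A `&` Ik q k) = mass s A.
Proof.
move=> q0 sT qn; rewrite /mass; under eq_bigr do rewrite big_mkcond.
rewrite exchange_big /= [RHS]big_mkcond big_seq [RHS]big_seq.
apply: eq_bigr => z zs; have [k kq zk] := Ik_exists q0 (sT _ zs).
rewrite (bigD1 (Ordinal (leq_trans kq qn))) //= big1 ?addr0.
  by rewrite in_setI [X in _ && X]mem_set // andbT.
move=> i /eqP ik; rewrite memNset // => -[_ zi]; apply: ik; apply: val_inj => /=.
exact: (Ik_inj q0 zi zk).
Qed.

Lemma mass_cover s A (I : eqType) (L : seq I) (B : I -> set R) : pos_mass s ->
  (forall z, z \in s -> A z.1 -> exists2 l, l \in L & B l z.1) ->
  mass s A <= \sum_(l <- L) mass s (B l).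
Proof.
elim: L A => [|l L IH] A s0 AB.
  rewrite big_nil mass0 // => z zs Az.
  by have [] := AB _ zs Az.
rewrite big_cons; apply: (@le_trans _ _ (mass s (B l) + mass s (A `\` B l))).
  rewrite /mass [leLHS]big_mkcond /= [X in X + _]big_mkcond [X in _ + X]big_mkcond.
  rewrite -big_split /= big_seq [leRHS]big_seq; apply: ler_sum => z zs.
  rewrite in_setD; case: (z.1 \in A) => /=.
    by case: (z.1 \in B l); rewrite /= ?addr0 ?add0r.
  by rewrite ?andbF addr0; case: ifP => // _; exact: s0.
rewrite lerD2l; apply: IH => // z zs [Az nBz].
have [l' + lz] := AB _ zs Az; rewrite inE => /orP[/eqP ll'|lL]; last by exists l'.
by rewrite ll' in lz.
Qed.

End PointMasses.

(** * Frostman's construction on a finite dyadic tree *)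

Section DyadicFrostman.
Variables (R : realType) (C : set R) (a : nat -> R) (J : nat).
Hypothesis a_ge0 : forall j, 0 <= a j.

(* The greedy construction, from the finest cells up, scales down the masses of
   a cell exactly when the cell exceeds its capacity; it is then optimal to
   cover the set inside this cell by the cell itself. *)
Lemma dyadic_frostman_cell d j k : (j + d)%N = J ->
  exists s (L : seq (nat * nat)),
  [/\ pos_mass s, forall z, z \in s -> (C `&` Ik (2 ^ j) k) z.1,
      forall j' k', (j <= j' <= J)%N -> mass s (Ik (2 ^ j') k') <= a j',
      forall x, (C `&` Ik (2 ^ j) k) x -> exists2 p, p \in L & Ik (2 ^ p.1) p.2 x &
      \sum_(p <- L) a p.1 <= mass s setT].
Proof.
elim: d j k => [|d IH] j k.
  rewrite addn0 => jJ.
  have [[x Cx]|Cn] := pselect (exists x, (C `&` Ik (2 ^ j) k) x).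
    exists [:: (x, a j)], [:: (j, k)]; split.
    - by move=> z; rewrite inE => /eqP -> /=; exact: a_ge0.
    - by move=> z; rewrite inE => /eqP ->.
    - move=> j' k' /andP[jj' j'J]; have -> : j' = j by lia.
      by rewrite /mass big_mkcond big_seq1 /=; case: (_ \in _) => /=; rewrite ?lexx ?a_ge0.
    - by move=> y [_ yk]; exists (j, k); rewrite ?inE.
    - by rewrite /mass [leRHS]big_mkcond !big_seq1 in_setT.
  exists [::], [::]; split => //.
  - by move=> j' k' _; rewrite /mass big_nil.
  - by move=> x Cx; case: Cn; exists x.
  - by rewrite /mass !big_nil.
move=> jdJ; have jdJ' : (j.+1 + d)%N = J by lia.
have p0 i : (0 < 2 ^ i)%N by rewrite expn_gt0.
have [s1 [L1 [s10 s1C s1a L1C L1s]]] := IH _ k.*2 jdJ'.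
have [s2 [L2 [s20 s2C s2a L2C L2s]]] := IH _ k.*2.+1 jdJ'.
have s0 : pos_mass (s1 ++ s2) by move=> z; rewrite mem_cat => /orP[/s10|/s20].
have sub b : (b <= 1)%N -> Ik (2 ^ j.+1) (k.*2 + b) `<=` (Ik (2 ^ j) k : set R).
  move=> b1; have := @Ik_pow2 R j j.+1 (k.*2 + b)%N (leqnSn _).
  suff -> : ((k.*2 + b) %/ 2 ^ (j.+1 - j) = k)%N by [].
  by rewrite subSnn expn1; lia.
have sC z : z \in s1 ++ s2 -> (C `&` Ik (2 ^ j) k) z.1.
  rewrite mem_cat => /orP[/s1C|/s2C] [Cz zk]; split=> //.
    by apply: (sub 0%N) => //; rewrite addn0.
  by apply: (sub 1%N) => //; rewrite addn1.
have sa j' k' : (j.+1 <= j' <= J)%N -> mass (s1 ++ s2) (Ik (2 ^ j') k') <= a j'.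
  move=> jj'; rewrite mass_cat.
  (* A cell of a level finer than [j] lies in at most one of the two halves, so at most one of the
     two families charges it. *)
  have [[z1 zs1 z1k]|n1] := pselect (exists2 z, z \in s1 & Ik (2 ^ j') k' z.1); last first.
    rewrite (mass0 (s := s1)) ?add0r; first exact: s2a.
    by move=> z zs zk; apply: n1; exists z.
  rewrite (mass0 (s := s2)) ?addr0; first exact: s1a.
  move=> z zs zk; have [jj1 _] := andP jj'.
  have e1 := Ik_inj (p0 _) (Ik_pow2 jj1 zk) (s2C _ zs).2.
  have e2 := Ik_inj (p0 _) (Ik_pow2 jj1 z1k) (s1C _ zs1).2.
  by lia.
have Ls : \sum_(p <- L1 ++ L2) a p.1 <= mass (s1 ++ s2) setT.
  by rewrite big_cat mass_cat lerD.
have [small|big] := lerP (mass (s1 ++ s2) setT) (a j).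
  exists (s1 ++ s2), (L1 ++ L2); split => //.
  - move=> j' k' /andP[]; rewrite leq_eqVlt => /orP[/eqP <- _|jj' j'J].
      by apply: le_trans small; apply: le_mass.
    by apply: sa; rewrite jj'.
  - move=> x [Cx /Ik_pow2_split [xk|xk]].
      by have [//|p pL xp] := L1C x; exists p => //; rewrite mem_cat pL.
    by have [//|p pL xp] := L2C x; exists p => //; rewrite mem_cat pL orbT.
set t := mass _ _ in Ls big; have t0 : 0 < t by apply: le_lt_trans big.
exists (scale_mass (a j / t) (s1 ++ s2)), [:: (j, k)]; split.
- move=> z /mapP[y ys ->] /=; rewrite mulr_ge0 ?(s0 _ ys) //.
  by rewrite divr_ge0 // ltW.
- by move=> z /mapP[y /sC ? ->].
- move=> j' k' /andP[]; rewrite leq_eqVlt mass_scale => /orP[/eqP <- _|jj' j'J].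
    rewrite -mulrA ler_piMr // mulrC ler_pdivrMr // mul1r.
    exact: le_mass.
  apply: (@le_trans _ _ (mass (s1 ++ s2) (Ik (2 ^ j') k'))); last by apply: sa; rewrite jj'.
  rewrite ler_piMl ?mass_ge0 // ler_pdivrMr // mul1r.
  exact: ltW.
- by move=> x [_ xk]; exists (j, k); rewrite ?inE.
- by rewrite big_seq1 mass_scale -/t divfK ?gt_eqF.
Qed.

End DyadicFrostman.
(** * Estimates for one block of indices *)

Section TestedLevels.
Variables (R : realType) (h : nat -> R) (j1 : nat).
Hypothesis h_gt0 : forall j, 0 < h j.

(* Levels at which h has dropped by a factor 2 since the previous tested one. *)
Fixpoint last_tested (t : nat) : nat :=
  if t is u.+1 then
    if 2 * h (j1 + t) < h (last_tested u) then (j1 + t)%N else last_tested u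
  else j1.

Definition tested (j : nat) : bool := (j1 <= j)%N && (last_tested (j - j1) == j).

Lemma last_tested_bounds t : (j1 <= last_tested t <= j1 + t)%N.
Proof.
elim: t => [|t /andP[a b]] /=; first by rewrite addn0 leqnn.
by case: ifP => _; lia.
Qed.

Lemma last_tested_h t : h (last_tested t) <= 2 * h (j1 + t).
Proof.
case: t => [|t] /=; first by rewrite addn0; have := h_gt0 j1; lra.
by case: ltP => // _; have := h_gt0 (j1 + t.+1)%N; lra.
Qed.

Lemma tested_last t : tested (last_tested t).
Proof.
elim: t => [|t IH]; first by rewrite /tested /= leqnn subnn /=.
rewrite [last_tested _]/=; case: ltP => // lt.
by rewrite /tested leq_addr /= addKn /= lt eqxx.
Qed.

(** The values of [1 / h] at least double from one tested level to the next, so the sum is of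
    geometric type and controlled by its last term. *)
Lemma sum_tested t :
  \sum_(j1 <= j < (j1 + t).+1 | tested j) (h j)^-1 <= 2 / h (last_tested t).
Proof.
elim: t => [|t IH].
  rewrite addn0 big_mkcond big_nat1 /=; case: ifP => _.
    by have : 0 < (h j1)^-1; [rewrite invr_gt0 | lra].
  by rewrite divr_ge0 ?ltW.
rewrite big_mkcond big_nat_recr /=; last by lia.
rewrite -big_mkcond /= addnS /tested -addnS addKn leq_addr /= !addnS.
have [lt|ge] := ltP (2 * h (j1 + t).+1) (h (last_tested t)).
  rewrite eqxx.
  have : 2 / h (last_tested t) <= (h (j1 + t).+1)^-1.
    rewrite ler_pdivrMr // mulrC ler_pdivlMr //; exact: ltW.
  by move: IH; rewrite /tested; lra.
have /andP[_ le] := last_tested_bounds t.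
by rewrite ltn_eqF ?addr0 // ltnS.
Qed.

End TestedLevels.

(** * Moments of the random density of one block *)

Section StageEstimate.
Variables (R : realType) (g h psi : nat -> R) (A : R).
Hypotheses (g_gt0 : forall j, 0 < g j) (h_gt0 : forall j, 0 < h j).
Hypothesis psi_gt0 : forall j, 0 < psi j.
Hypothesis h_noninc : forall i j, (i <= j)%N -> h j <= h i.
Hypothesis psi_nondec : forall i j, (i <= j)%N -> psi i <= psi j.
Hypothesis gpsi_le : forall j, g j * psi j <= A * h j.
Variables (q lv : nat -> nat).
Hypothesis q_gt0 : forall n, (0 < q n)%N.
Hypothesis q_lv : forall n, (q n <= 2 ^ lv n < 2 * q n)%N.

Let s j := g j / h j.
Let p n : R := (q n)%:R^-1.

Let A_ge0 : 0 <= A.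
Proof.
by rewrite -(pmulr_lge0 _ (h_gt0 0)); apply: le_trans (gpsi_le 0); rewrite mulr_ge0 ?ltW.
Qed.

Let p_gt0 n : 0 < p n.
Proof. by rewrite invr_gt0 ltr0n. Qed.

Let p_ge0 n : 0 <= p n. Proof. exact: ltW. Qed.
Let g_ge0 j : 0 <= g j. Proof. exact: ltW. Qed.
Let h_ge0 j : 0 <= h j. Proof. exact: ltW. Qed.
Let psi_ge0 j : 0 <= psi j. Proof. exact: ltW. Qed.

Let spsi j : s j * psi j <= A.
Proof. by rewrite /s mulrAC ler_pdivrMr. Qed.

Let pow_gt0 i : (0 < 2 ^ i)%N.
Proof. by rewrite expn_gt0. Qed.

Variables (N0 N Q j1 J : nat) (B eps : R) (mu : seq (R * R)).
Hypothesis s_noninc : forall i j, (j1 <= i <= j)%N -> s j <= s i.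
Hypothesis q_le : forall n, (n < N)%N -> (q n <= Q)%N.
Hypothesis lv_le : forall n, (n < N)%N -> (lv n <= J)%N.
Hypothesis j1J : (j1 <= J)%N.
Hypothesis B_gt0 : 0 < B.
Hypothesis eps_gt0 : 0 < eps.
Hypothesis eps_le : eps <= 3^-1.
Hypothesis mu_ge0 : pos_mass mu.
Hypothesis mu_torus : forall z, z \in mu -> torus z.1.
Hypothesis mu_g : forall j k, (j <= J)%N -> mass mu (Ik (2 ^ j) k) <= B * g j.
Hypothesis mu_h : forall j k, (j <= J)%N -> mass mu (Ik (2 ^ j) k) <= h j.
Hypothesis s_small : forall j, (j1 <= j)%N -> B * s j <= eps / 2.

(** With this threshold, [zeta / s j] times the capacity [B * g j] is exactly [eps * h j]. *)
Let zeta := eps / B.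

Let zeta_gt0 : 0 < zeta.
Proof. exact: divr_gt0. Qed.

Definition block_sum : R := \sum_(n < N | (N0 <= n)%N) p n * psi (lv n).
Hypothesis S_gt0 : 0 < block_sum.

Definition wgt (n : 'I_N) : R := if (N0 <= n)%N then psi (lv n) / block_sum else 0.

Let wgt_ge0 n : 0 <= wgt n.
Proof. by rewrite /wgt; case: ifP => // _; rewrite divr_ge0 ?ltW. Qed.

Let sum_wgt : \sum_n wgt n * p n = 1.
Proof.
rewrite -[RHS](@divff _ block_sum) ?gt_eqF // {2}/block_sum mulr_suml [RHS]big_mkcond.
apply: eq_bigr => n _; rewrite /wgt; case: ifP => _; last by rewrite mul0r.
by rewrite mulrAC [psi _ * _]mulrC.
Qed.

(** The uniform law on [q n] cells, extended by 0 so that all indices of a block share the outcome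
    type ['I_Q]. *)
Definition outcome_prob (n : 'I_N) (k : 'I_Q) : R := if (k < q n)%N then p n else 0.

Let prob_ge0 n k : 0 <= outcome_prob n k.
Proof. by rewrite /outcome_prob; case: ifP => // _; rewrite ltW. Qed.

Let prob_mass (t : seq (R * R)) (D : set R) n (k : 'I_Q) : (forall z, z \in t -> torus z.1) ->
  outcome_prob n k * mass t (D `&` Ik (q n) k) = p n * mass t (D `&` Ik (q n) k).
Proof.
move=> tT; rewrite /outcome_prob; case: ltnP => // qk.
by rewrite mass0 ?mulr0 // => z /tT zT [_ /(Ik_lt zT)]; rewrite ltnNge qk.
Qed.

Lemma outcome_prob_sum1 n : \sum_k outcome_prob n k = 1.
Proof.
rewrite /outcome_prob -big_mkcond /= -(big_ord_widen _ (fun=> p n)) ?q_le //.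
by rewrite sumr_const card_ord -mulr_natl mulfV // pnatr_eq0 -lt0n.
Qed.

Let mean_mass (t : seq (R * R)) (D : set R) n : (forall z, z \in t -> torus z.1) ->
  emean outcome_prob n (fun k => mass t (D `&` Ik (q n) k)) = p n * mass t D.
Proof.
move=> tT; rewrite /emean; under eq_bigr do rewrite prob_mass //.
by rewrite -mulr_sumr mass_sum_cells // q_le.
Qed.

Definition ind (n : 'I_N) (k : 'I_Q) (x : R) : R := (x \in (Ik (q n) k : set R))%:R.

Let ind_ge0 n k x : 0 <= ind n k x.
Proof. by rewrite /ind ler0n. Qed.

Let mean_ind n x : torus x -> emean outcome_prob n (fun k => ind n k x) = p n.
Proof.
move=> xT; have := @mean_mass [:: (x, 1)] setT n.
rewrite {2}/mass big_mkcond big_seq1 /= in_setT mulr1 => <-; last first.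
  by move=> z; rewrite inE => /eqP ->.
apply: eq_bigr => k _; rewrite /mass big_mkcond big_seq1 /= setTI /ind.
by case: (_ \in _).
Qed.

(** Since [2 ^ lv n < 2 * q n], a cell of length [1 / q n] is shorter than two dyadic cells of level
    [lv n], hence meets at most three of them. *)
Let mu_Ik n k (D : set R) : (n < N)%N ->
  mass mu (D `&` Ik (q n) k) <= 3 * B * g (lv n).
Proof.
(* [l] is the index of the dyadic cell that contains the left endpoint [k / q n]. *)
move=> nN; set i := lv n; set l := (2 ^ i * k %/ q n)%N.
have -> : 3 * B * g i = \sum_(b <- [:: 0; 1; 2]%N) B * g i.
  by rewrite !big_cons big_nil; ring.
apply: (@le_trans _ _ (\sum_(b <- [:: 0; 1; 2]%N) mass mu (Ik (2 ^ i) (l + b)))); last first.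
  by apply: ler_sum => b _; apply: mu_g; exact: lv_le.
apply: mass_cover => // z zs [_ /(in_Ik _ _ (q_gt0 n))/andP[za zb]].
have zT := mu_torus zs; have [l' l'i zl'] := Ik_exists (pow_gt0 i) zT.
have /(in_Ik _ _ (pow_gt0 i))/andP[la lb] := zl'.
have /andP[qa qb] := q_lv n.
have qR : 0 < (q n)%:R :> R by rewrite ltr0n.
have twoR : 0 < (2 ^ i)%:R :> R by rewrite ltr0n.
have e1 : (2 ^ i * k < l'.+1 * q n)%N.
  rewrite -(ltr_nat R) !natrM; apply: (@le_lt_trans _ _ ((2 ^ i)%:R * ((q n)%:R * z.1))).
    by rewrite ler_pM2l.
  by rewrite mulrCA mulrC ltr_pM2r.
have e2 : (l' * q n < 2 ^ i * k.+1)%N.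
  rewrite -(ltr_nat R) !natrM; apply: (@le_lt_trans _ _ ((2 ^ i)%:R * ((q n)%:R * z.1))).
    by rewrite mulrCA mulrC ler_pM2l.
  by rewrite ltr_pM2l.
have := leq_divM (2 ^ i * k) (q n); have := ltn_ceil (2 ^ i * k) (q_gt0 n).
rewrite -/l => e3 e4.
have e5 : (l <= l')%N.
  rewrite -ltnS -(ltn_pmul2r (q_gt0 n)); apply: leq_ltn_trans e4 _.
  by [].
have e6 : (l' - l < 3)%N.
  rewrite ltn_subLR // -(ltn_pmul2r (q_gt0 n)); apply: (leq_trans e2).
  rewrite (_ : l + 3 = 2 + l.+1)%N; last by rewrite addnC !addSn addnS.
  by rewrite mulnS mulnDl leq_add ?(ltnW qb) ?(ltnW e3).
exists (l' - l)%N; last by rewrite subnKC.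
by move: (l' - l)%N e6 => [|[|[|]]].
Qed.

(** This is the integral of [dens v c] over [D] against [mu], as [blkE] shows; the present form
    displays it as a sum of independent terms. *)
Definition blk (v : 'I_N -> R) (D : set R) (c : {ffun 'I_N -> 'I_Q}) : R :=
  \sum_n v n * mass mu (D `&` Ik (q n) (c n)).

Definition dens (v : 'I_N -> R) (c : {ffun 'I_N -> 'I_Q}) (x : R) : R :=
  \sum_n v n * ind n (c n) x.

Lemma blkE v D c : blk v D c = \sum_(z <- mu | z.1 \in D) z.2 * dens v c z.1.
Proof.
rewrite /blk /dens; under [RHS]eq_bigr do rewrite mulr_sumr.
rewrite exchange_big /=; apply: eq_bigr => n _.
rewrite /mass mulr_sumr big_mkcond [RHS]big_mkcond /=; apply: eq_bigr => z _.
rewrite in_setI /ind; case: (z.1 \in D) => //=.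
by case: (z.1 \in _); rewrite /= ?mulr1 ?mulr0 // mulrC.
Qed.

(** In each second moment, one factor is bounded by [mu_Ik] and the other is averaged, which gives
    [p n * mass mu D]. *)
Lemma blk_var v D :
  pexp outcome_prob
    (fun c => (blk v D c - mass mu D * \sum_n v n * p n) ^+ 2) <=
  3 * B * mass mu D * \sum_n v n ^+ 2 * p n * g (lv n).
Proof.
have E n : emean outcome_prob n (fun k => v n * mass mu (D `&` Ik (q n) k)) =
    mass mu D * (v n * p n).
  rewrite /emean; under eq_bigr do rewrite mulrCA.
  by rewrite -mulr_sumr [\sum_(_ < _) _]mean_mass //; ring.
have -> : mass mu D * \sum_n v n * p n =
    \sum_n emean outcome_prob n (fun k => v n * mass mu (D `&` Ik (q n) k)).
  by rewrite mulr_sumr; apply: eq_bigr => n _; rewrite E.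
apply: le_trans (pexp_variance_le outcome_prob_sum1
  (fun n k => v n * mass mu (D `&` Ik (q n) k))) _.
rewrite mulr_sumr; apply: ler_sum => n _.
apply: (@le_trans _ _ (v n ^+ 2 * (3 * B * g (lv n)) *
    emean outcome_prob n (fun k => mass mu (D `&` Ik (q n) k)))).
  rewrite /emean mulr_sumr; apply: ler_sum => k _.
  rewrite [leRHS]mulrCA ler_wpM2l ?prob_ge0 // exprMn -[leRHS]mulrA ler_wpM2l ?sqr_ge0 // expr2.
  by rewrite ler_wpM2r ?mass_ge0 // mu_Ik.
rewrite mean_mass // le_eqVlt; apply/orP; left; apply/eqP; ring.
Qed.

Definition wgt_gt j (n : 'I_N) : R := if (j < lv n)%N then wgt n else 0.
(** The level is cut off at [j1] because [s] is only known to be nonincreasing from there. *)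
Definition wgt_s (n : 'I_N) : R := wgt n * s (maxn (lv n) j1).

Let s_ge0 j : 0 <= s j.
Proof. by rewrite divr_ge0 ?ltW. Qed.

Let wgt_gt_ge0 j n : 0 <= wgt_gt j n.
Proof. by rewrite /wgt_gt; case: ifP. Qed.

Let wgt_gt_le j n : wgt_gt j n <= wgt n.
Proof. by rewrite /wgt_gt; case: ifP. Qed.

Let wgt_s_ge0 n : 0 <= wgt_s n.
Proof. by rewrite mulr_ge0. Qed.

Let dens_ge0 v c x : (forall n, 0 <= v n) -> 0 <= dens v c x.
Proof. by move=> v0; apply: sumr_ge0 => n _; rewrite mulr_ge0. Qed.

Definition cell_level_sum (P : pred nat) (a b : nat) (F : nat -> nat -> R) : R :=
  \sum_(a <= j < b | P j) \sum_(k < 2 ^ j) F j k.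

(** By Markov's inequality this dominates the mass, for the measure with density [dens wgt c], of
    the points where [dens wgt_s c] exceeds [zeta]. *)
Definition overflow c : R :=
  zeta^-1 * \sum_(z <- mu) z.2 * (dens wgt c z.1 * dens wgt_s c z.1).

(** If [blk] exceeds [eps * h j] on a cell, its deviation will be at least half of it; the factor 8
    then makes the term of this cell at least twice [blk]. *)
Definition fine_dev c : R := cell_level_sum (tested h j1) j1 J.+1 (fun j k =>
  8 / (eps * h j) * (blk (wgt_gt j) (Ik (2 ^ j) k) c -
     mass mu (Ik (2 ^ j) k) * \sum_n wgt_gt j n * p n) ^+ 2).

(** Normalized so that a value at most [eps] forces every single deviation below [eps * h j1]. *)
Definition coarse_dev c : R := (eps * h j1 ^+ 2)^-1 *
  cell_level_sum xpredT 0 j1.+1 (fun j k =>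
   (blk wgt (Ik (2 ^ j) k) c - mass mu (Ik (2 ^ j) k)) ^+ 2).

Definition badness c : R := overflow c + fine_dev c + coarse_dev c.

Let mu_sum_cells j : \sum_(k < 2 ^ j) mass mu (Ik (2 ^ j) k) = mass mu setT.
Proof.
rewrite -(mass_sum_cells setT (q := 2 ^ j) (n := 2 ^ j) _ mu_torus) //.
by apply: eq_bigr => k _; rewrite setTI.
Qed.

Let T_ge0 : 0 <= mass mu setT. Proof. exact: mass_ge0. Qed.

Let overflow_ge0 c : 0 <= overflow c.
Proof.
apply: mulr_ge0; first by rewrite invr_ge0 ltW.
rewrite big_seq sumr_ge0 // => z zs.
by rewrite mulr_ge0 ?mu_ge0 // mulr_ge0 // dens_ge0.
Qed.

Let cell_level_sum_ge0 P a b F : (forall j k, 0 <= F j k) -> 0 <= cell_level_sum P a b F.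
Proof. by move=> F0; apply: sumr_ge0 => j _; apply: sumr_ge0 => k _. Qed.

Let fine_dev_ge0 c : 0 <= fine_dev c.
Proof.
apply: cell_level_sum_ge0 => j k; rewrite mulr_ge0 ?sqr_ge0 // divr_ge0 // mulr_ge0 // ltW //.
Qed.

Let coarse_dev_ge0 c : 0 <= coarse_dev c.
Proof.
apply: mulr_ge0; first by rewrite invr_ge0 mulr_ge0 ?sqr_ge0 // ltW.
by apply: cell_level_sum_ge0 => j k; rewrite sqr_ge0.
Qed.

Lemma badness_ge0 c : 0 <= badness c.
Proof. by rewrite addr_ge0 // addr_ge0. Qed.

(* One factor wgt n is spent against psi (lv n), leaving the probability weights wgt n * p n. *)
Let wgt2_le (u : nat -> R) K : (forall n, 0 <= u n) -> (forall n, psi (lv n) * u n <= K) ->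
  \sum_(n < N) wgt n ^+ 2 * p n * u n <= K / block_sum.
Proof.
move=> u0 uK; have K0 : 0 <= K by apply: le_trans (uK 0%N); rewrite mulr_ge0 // ltW.
rewrite -[leRHS]mul1r -sum_wgt mulr_suml; apply: ler_sum => n _.
rewrite expr2 -!mulrA ler_wpM2l // mulrCA ler_wpM2l //.
rewrite /wgt; case: ifP => _; last by rewrite mul0r divr_ge0 // ltW.
by rewrite ler_pdivlMr // mulrAC divfK // gt_eqF.
Qed.

(** At each point, the product of the two means is at most [1 * s j1], and the diagonal term of
    [pexp_mul_le] is at most [A / block_sum] by [wgt2_le]. *)
Let overflow_le : pexp outcome_prob overflow <=
  mass mu setT * ((s j1 + A / block_sum) * B / eps).
Proof.
have -> : mass mu setT * ((s j1 + A / block_sum) * B / eps) =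
    zeta^-1 * \sum_(z <- mu) z.2 * (s j1 + A / block_sum).
  rewrite -mulr_suml /mass (eq_bigl xpredT) => [|z]; last by rewrite in_setT.
  by rewrite /zeta invf_div; ring.
rewrite /overflow pexpZ ler_wpM2l //; first by rewrite invr_ge0 ltW.
rewrite pexp_sum.
rewrite big_seq [leRHS]big_seq; apply: ler_sum => z zs.
rewrite pexpZ ler_wpM2l ?mu_ge0 //.
set u := fun (n : 'I_N) k => wgt n * ind n k z.1.
set v := fun (n : 'I_N) k => wgt_s n * ind n k z.1.
have mZ (a : R) n : emean outcome_prob n (fun k => a * ind n k z.1) = a * p n.
  rewrite /emean; under eq_bigr do rewrite mulrCA.
  by rewrite -mulr_sumr [\sum_(_ < _) _]mean_ind //; exact: mu_torus.
apply: le_trans (pexp_mul_le prob_ge0 outcome_prob_sum1 (u := u) (v := v) _ _) _.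
- by move=> n k; rewrite mulr_ge0.
- by move=> n k; rewrite mulr_ge0.
under eq_bigr do rewrite mZ.
rewrite sum_wgt mul1r; apply: lerD.
  under eq_bigr do rewrite mZ.
  rewrite -[leRHS]mul1r -sum_wgt mulr_suml; apply: ler_sum => n _.
  rewrite /wgt_s mulrAC ler_wpM2l ?mulr_ge0 //.
  by apply: s_noninc; rewrite leqnn leq_maxr.
apply: le_trans (wgt2_le (u := fun n => s (maxn (lv n) j1)) _ (K := A) _) => //.
  apply: ler_sum => n _.
  have -> : emean outcome_prob n (fun k => u n k * v n k) = wgt n * wgt_s n * p n.
    rewrite -mZ; apply: eq_bigr => k _; congr (_ * _); rewrite /u /v /ind.
    by case: (_ \in _) => /=; ring.
  by rewrite le_eqVlt /wgt_s; apply/orP; left; apply/eqP; ring.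
move=> n; rewrite mulrC; apply: le_trans (spsi (maxn (lv n) j1)).
by rewrite ler_wpM2l // psi_nondec // leq_maxl.
Qed.

(** After summing variances over the cells of a level, the sums are exchanged: an index [n] is
    charged [(h j)^-1] for each tested [j] below [lv n]. By [sum_tested] these charges total at most
    [2 / h (lv n)], which turns [g (lv n)] into [2 * s (lv n)]. *)
Let fine_dev_le : pexp outcome_prob fine_dev <=
  mass mu setT * (48 * B * A / (eps * block_sum)).
Proof.
rewrite /fine_dev /cell_level_sum pexp_sum.
apply: (@le_trans _ _ (\sum_(j1 <= j < J.+1 | tested h j1 j)
   mass mu setT * (24 * B / eps) * ((h j)^-1 * \sum_n wgt_gt j n ^+ 2 * p n * g (lv n)))).
  apply: ler_sum => j _; rewrite pexp_sum.
  rewrite -(mu_sum_cells j) -!mulrA mulr_suml; apply: ler_sum => k _.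
  rewrite pexpZ; apply: le_trans (ler_wpM2l _ (blk_var _ _)) _.
    by rewrite divr_ge0 // mulr_ge0 // ltW.
  by rewrite le_eqVlt; apply/orP; left; apply/eqP; rewrite invfM; ring.
rewrite -mulr_sumr.
have -> : mass mu setT * (48 * B * A / (eps * block_sum)) =
    mass mu setT * (24 * B / eps) * (2 * A / block_sum) by rewrite invfM; ring.
rewrite ler_wpM2l //; first by rewrite mulr_ge0 // divr_ge0 ?mulr_ge0 ?ltW.
under eq_bigr do rewrite mulr_sumr.
rewrite exchange_big /=.
apply: le_trans (wgt2_le (u := fun n => 2 * s (lv n)) _ (K := 2 * A) _); last 2 first.
- by move=> n; rewrite mulr_ge0.
- by move=> n; rewrite mulrCA ler_wpM2l // mulrC.
apply: ler_sum => n _.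
apply: (@le_trans _ _ (wgt n ^+ 2 * p n * g (lv n) *
    \sum_(j1 <= j < J.+1 | tested h j1 j && (j < lv n)%N) (h j)^-1)).
  rewrite mulr_sumr [leRHS]big_mkcondr /=; apply: ler_sum => j _; rewrite /wgt_gt.
  by case: ifP => _; rewrite ?expr0n ?mul0r ?mulr0 // mulrC.
rewrite -[leLHS]mulrA ler_wpM2l //; first by rewrite mulr_ge0 // sqr_ge0.
rewrite /s mulrCA ler_wpM2l //.
have [lj|jl] := leqP (lv n) j1.
  rewrite big_nat_cond big1 ?mulr_ge0 ?invr_ge0 ?ltW // => j.
  by case/andP => /andP[a b] /andP[_ c]; lia.
(* The levels that remain are those up to [j1 + t], the last one before [lv n]. *)
set t := (lv n - j1.+1)%N; have et : lv n = (j1 + t).+1 by rewrite /t; lia.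
apply: (@le_trans _ _ (2 / h (last_tested h j1 t))).
  apply: le_trans _ (sum_tested j1 h_gt0 t).
  have le : ((j1 + t).+1 <= J.+1)%N by rewrite -et; apply/leqW/lv_le.
  rewrite (big_cat_nat _ (n := (j1 + t).+1)) //=; last by lia.
  rewrite [X in _ + X]big_nat_cond [X in _ + X]big1 ?addr0; last first.
    by move=> j /andP[/andP[a b] /andP[_ c]]; lia.
  by rewrite big_mkcondr; apply: ler_sum => j _; case: ifP => // _; rewrite invr_ge0 ltW.
rewrite ler_wpM2l // lef_pV2 ?posrE // h_noninc //.
have /andP[_] := last_tested_bounds h j1 t; lia.
Qed.

(** There are only [j1.+1] coarse levels, so the crude bound [g * psi <= A * h 0] suffices: the
    length of the block absorbs the constant. *)
Let coarse_dev_le : pexp outcome_prob coarse_dev <=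
  mass mu setT * (3 * (j1.+1)%:R * B * A * h 0 / (eps * h j1 ^+ 2 * block_sum)).
Proof.
rewrite /coarse_dev pexpZ /cell_level_sum pexp_sum.
rewrite [leRHS](_ : _ = (eps * h j1 ^+ 2)^-1 *
    (\sum_(0 <= j < j1.+1) (3 * B * mass mu setT * (A * h 0 / block_sum)))); last first.
  by rewrite sumr_const_nat subn0 -mulr_natr [(_ * block_sum)^-1]invfM; ring.
rewrite ler_wpM2l //; first by rewrite invr_ge0 mulr_ge0 ?sqr_ge0 // ltW.
apply: ler_sum => j _; rewrite pexp_sum -(mu_sum_cells j) mulr_sumr mulr_suml.
apply: ler_sum => k _.
have := blk_var wgt (Ik (2 ^ j) k); rewrite sum_wgt mulr1 => le; apply: le_trans le _.
rewrite ler_wpM2l //; first by rewrite !mulr_ge0 ?mass_ge0 // ltW.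
apply: (wgt2_le (u := fun n => g (lv n))) => n; first exact: ltW.
rewrite mulrC; apply: le_trans (gpsi_le _) _.
by rewrite ler_wpM2l // h_noninc.
Qed.

Lemma badness_mean_le : pexp outcome_prob badness <= mass mu setT *
  ((s j1 + A / block_sum) * B / eps + 48 * B * A / (eps * block_sum) +
   3 * (j1.+1)%:R * B * A * h 0 / (eps * h j1 ^+ 2 * block_sum)).
Proof.
rewrite /badness !pexpD !mulrDr; apply: lerD; last exact: coarse_dev_le.
by apply: lerD; [exact: overflow_le | exact: fine_dev_le].
Qed.


(** * Trimming the weighted measure for an outcome of small badness *)

Section GoodOutcome.
Variable c : {ffun 'I_N -> 'I_Q}.
Hypothesis c_good : badness c <= eps.

Let f := dens wgt c.
Let Z := dens wgt_s c.

Let f_ge0 x : 0 <= f x. Proof. exact: dens_ge0. Qed.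
Let Z_ge0 x : 0 <= Z x. Proof. exact: dens_ge0. Qed.

Let overflow_eps : overflow c <= eps - fine_dev c.
Proof. by move: c_good; rewrite /badness; have := coarse_dev_ge0 c; lra. Qed.

Let coarse_dev_eps : coarse_dev c <= eps.
Proof.
by move: c_good; rewrite /badness; have := overflow_ge0 c; have := fine_dev_ge0 c; lra.
Qed.

(** An index with [lv n <= j] has [wgt n * s j <= wgt_s n]. Where [Z <= zeta], such indices
    therefore contribute at most [zeta / s j] to [f], and the other indices make up [wgt_gt j]. *)
Let bounded_overflow_le j (D : set R) : (j1 <= j)%N ->
  \sum_(z <- mu | (z.1 \in D) && (Z z.1 <= zeta)) z.2 * f z.1 <=
  zeta / s j * mass mu D + blk (wgt_gt j) D c.
Proof.
move=> j1j; have s_gt0 i : 0 < s i by rewrite divr_gt0.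
rewrite blkE /mass mulr_sumr -big_split /= big_mkcondr /= big_seq_cond [leRHS]big_seq_cond.
apply: ler_sum => z /andP[/mu_ge0 z0 _].
rewrite [_ * z.2]mulrC -mulrDr; case: ifP => [Zz|_]; last first.
  by rewrite mulr_ge0 // addr_ge0 ?dens_ge0 // divr_ge0 // ltW.
rewrite ler_wpM2l // -lerBlDr ler_pdivlMr //; apply: le_trans Zz.
rewrite /f /Z /dens -sumrB mulr_suml; apply: ler_sum => n _.
rewrite -mulrBl mulrAC ler_wpM2r // /wgt_gt /wgt_s; case: ltnP => [_|lvj].
  by rewrite subrr mul0r mulr_ge0.
by rewrite subr0 ler_wpM2l // s_noninc // leq_maxr geq_max lvj.
Qed.

Let cell_overflow_le j k : (j1 <= j <= J)%N ->
  zeta / s j * mass mu (Ik (2 ^ j) k) <= eps * h j.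
Proof.
move=> /andP[j1j jJ]; apply: (@le_trans _ _ (zeta / s j * (B * g j))).
  by rewrite ler_wpM2l ?mu_g // divr_ge0 // ltW.
rewrite le_eqVlt; apply/orP; left; apply/eqP; rewrite /zeta /s.
by field; rewrite !gt_eqF.
Qed.

Let coarse_cell j k : (j <= j1)%N -> (k < 2 ^ j)%N ->
  `|blk wgt (Ik (2 ^ j) k) c - mass mu (Ik (2 ^ j) k)| <= eps * h j1.
Proof.
move=> jj1 kj; have e0 : 0 <= eps * h j1 by rewrite ltW // mulr_gt0.
rewrite -ler_sqr ?nnegrE // real_normK ?num_real //.
have := coarse_dev_eps; rewrite /coarse_dev mulrC ler_pdivrMr ?mulr_gt0 ?exprn_gt0 //.
rewrite mulrA -expr2 -exprMn; apply: le_trans.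
have jl : j \in index_iota 0 j1.+1 by rewrite mem_index_iota ltnS.
rewrite /cell_level_sum (bigD1_seq j jl (iota_uniq _ _)) /=.
rewrite (bigD1 (Ordinal kj)) // -addrA lerDl addr_ge0 //.
  by apply: sumr_ge0 => i _; exact: sqr_ge0.
by apply: sumr_ge0 => i _; apply: sumr_ge0 => l _; exact: sqr_ge0.
Qed.

Let fine_levels := [seq j <- index_iota j1 J.+1 | tested h j1 j].

Let bad_cells := [seq p <- [seq (j, k) | j <- fine_levels, k <- index_iota 0 (2 ^ j)] |
  eps * h p.1 < blk (wgt_gt p.1) (Ik (2 ^ p.1) p.2) c].

(** Positivity of [f] places [x] in a cell of the block; the other two conditions control the larger
    and the smaller cells of the block. *)
Let good (x : R) := [&& 0 < f x, Z x <= zeta &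
  all (fun p => x \notin (Ik (2 ^ p.1) p.2 : set R)) bad_cells].

Let mu' := [seq (z.1, z.2 * f z.1) | z <- mu & good z.1].

Let mass_mu' D : mass mu' D = \sum_(z <- mu | good z.1 && (z.1 \in D)) z.2 * f z.1.
Proof. by rewrite /mass big_map big_filter_cond. Qed.

Let bad_cells_level l : l \in bad_cells -> (j1 <= l.1 <= J)%N.
Proof.
rewrite mem_filter => /andP[_ /allpairsPdep[j [k [+ _ ->]]]] /=.
by rewrite mem_filter mem_index_iota ltnS => /andP[].
Qed.

(* On a bad cell D the deviation of blk from its mean, which is at most half of
   the threshold eps * h j, is comparable to blk itself. *)
Let bad_cell_mass_le l : l \in bad_cells ->
  \sum_(z <- mu | (z.1 \in Ik (2 ^ l.1) l.2) && (Z z.1 <= zeta)) z.2 * f z.1 <=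
  8 / (eps * h l.1) * (blk (wgt_gt l.1) (Ik (2 ^ l.1) l.2) c -
     mass mu (Ik (2 ^ l.1) l.2) * \sum_n wgt_gt l.1 n * p n) ^+ 2.
Proof.
move=> pb; have /andP[j1j jJ] := bad_cells_level pb.
move: pb; rewrite mem_filter => /andP[bad _].
case: l => [j k] /= in j1j jJ bad *.
apply: le_trans (bounded_overflow_le _ j1j) _.
have le1 := cell_overflow_le k (introT andP (conj j1j jJ)).
set y := blk _ _ _ in bad *; set m := mass _ _ in le1 *.
set w := \sum_n _; have w1 : 0 <= w <= 1.
  rewrite sumr_ge0 /= => [|n _]; last by rewrite mulr_ge0.
  by rewrite -sum_wgt; apply: ler_sum => n _; rewrite ler_wpM2r.
have m0 : 0 <= m by exact: mass_ge0.
have mw : m * w <= eps * h j / 2.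
  apply: (@le_trans _ _ m); first by rewrite ler_piMr //; case/andP: w1.
  apply: le_trans (mu_g _ jJ) _; have := s_small j1j.
  by rewrite /s mulrA ler_pdivrMr // mulrAC.
set e := eps * h j in bad mw le1 *; have e0 : 0 < e by rewrite mulr_gt0.
rewrite [leRHS]mulrAC ler_pdivlMr //.
have d0 : y / 2 <= y - m * w by lra.
have : (y / 2) ^+ 2 <= (y - m * w) ^+ 2 by rewrite lerXn2r ?nnegrE //; lra.
move: bad le1 e0; nra.
Qed.

(** The coarse estimate at the root cell puts the integral of [f] within [eps * h 0] of the mass of
    [mu]; what is trimmed off is at most [overflow c + fine_dev c], hence at most [eps]. *)
Let kept_mass_ge : mass mu setT - eps * (1 + h 0) <= mass mu' setT.
Proof.
have bad_le : \sum_(p <- bad_cells)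
    \sum_(z <- mu | (z.1 \in Ik (2 ^ p.1) p.2) && (Z z.1 <= zeta)) z.2 * f z.1 <= fine_dev c.
  apply: (@le_trans _ _ (\sum_(l <- bad_cells) 8 / (eps * h l.1) *
     (blk (wgt_gt l.1) (Ik (2 ^ l.1) l.2) c -
     mass mu (Ik (2 ^ l.1) l.2) * \sum_n wgt_gt l.1 n * p n) ^+ 2)).
    by rewrite big_seq [leRHS]big_seq; apply: ler_sum => l; exact: bad_cell_mass_le.
  rewrite /bad_cells big_filter big_mkcond /= big_allpairs_dep /= big_filter.
  apply: ler_sum => j _; rewrite big_mkord; apply: ler_sum => k _.
  case: ifP => _ //; rewrite mulr_ge0 ?sqr_ge0 // divr_ge0 // mulr_ge0 //; exact: ltW.
have total : mass mu setT - eps * h 0 <= blk wgt setT c.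
  have E0 : forall z, z \in mu -> (Ik (2 ^ 0) 0 : set R) z.1.
    move=> z /mu_torus; rewrite /torus /Ik /= in_itv /= !divr1.
    by [].
  have -> : mass mu setT = mass mu (Ik (2 ^ 0) 0).
    by apply/eqP; rewrite eq_le !le_mass // => z zs _; exact: E0.
  have -> : blk wgt setT c = blk wgt (Ik (2 ^ 0) 0) c.
    rewrite !blkE big_mkcond [RHS]big_mkcond big_seq [RHS]big_seq; apply: eq_bigr => z zs.
    by rewrite in_setT mem_set //; exact: E0.
  have h0 := h_noninc (leq0n j1).
  have : eps * h j1 <= eps * h 0 by rewrite ler_wpM2l // ltW.
  by have := coarse_cell (leq0n j1) (pow_gt0 0); rewrite ler_norml => /andP[]; lra.
have split : blk wgt setT c <= mass mu' setT + overflow c +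
   \sum_(p <- bad_cells)
    \sum_(z <- mu | (z.1 \in Ik (2 ^ p.1) p.2) && (Z z.1 <= zeta)) z.2 * f z.1.
  rewrite blkE mass_mu' /overflow mulr_sumr; under [X in _ + X]eq_bigr do rewrite big_mkcond.
  rewrite exchange_big /= big_mkcond [X in X + _ + _]big_mkcond -!big_split /=.
  rewrite big_seq [leRHS]big_seq; apply: ler_sum => z zs.
  have zf0 : 0 <= z.2 * f z.1 by rewrite mulr_ge0 ?mu_ge0.
  have o0 : 0 <= zeta^-1 * (z.2 * (dens wgt c z.1 * dens wgt_s c z.1)).
    by rewrite mulr_ge0 ?invr_ge0 ?(ltW zeta_gt0) // mulrA mulr_ge0.
  have b0 : 0 <= \sum_(p <- bad_cells)
      (if (z.1 \in Ik (2 ^ p.1) p.2) && (Z z.1 <= zeta) then z.2 * f z.1 else 0).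
    by apply: sumr_ge0 => l _; case: ifP.
  rewrite in_setT andbT; case: ifP => [_|]; first by rewrite -addrA ler_wpDr // addr_ge0.
  have [fz|fz] := ltP 0 (f z.1); last first.
    have zf : z.2 * f z.1 <= 0 by rewrite mulr_ge0_le0 ?mu_ge0.
    by move=> _; apply: le_trans zf _; rewrite add0r addr_ge0.
  rewrite /good fz /=; have /orP[Zz|Zz] : (Z z.1 <= zeta) || (zeta < Z z.1) by case: leP.
  rewrite Zz /=;  move=> /negbT /allPn[l lb]; rewrite negbK => zl.
    rewrite add0r ler_wpDl // (big_rem l) //= zl /= lerDl.
    by apply: sumr_ge0 => l' _; case: ifP.
  move=> _; rewrite add0r ler_wpDr // [leRHS]mulrC -/f -/Z.
  by rewrite ler_pdivlMr // mulrA ler_wpM2l // ltW.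
have := overflow_eps; lra.
Qed.

Let kept_mass_le (D : set R) : mass mu' D <= blk wgt D c.
Proof.
rewrite mass_mu' blkE big_mkcond [leRHS]big_mkcond big_seq [leRHS]big_seq.
apply: ler_sum => z zs; have : 0 <= z.2 * f z.1 by rewrite mulr_ge0 ?mu_ge0.
by case: (good _); case: (_ \in _).
Qed.

(** Before level [j1] this is the coarse estimate. From [j1] on, a cell that holds a good point has
    an ancestor at the last tested level [i] which is not bad. The smaller cells of the block thus
    contribute at most [eps * h i <= 2 * eps * h j], the larger ones at most [eps * h j], and
    [3 * eps <= 1]. *)
Let kept_mass_h j k : (j <= J)%N -> mass mu' (Ik (2 ^ j) k) <= (1 + eps) * h j.
Proof.
move=> jJ; have [j1j|jj1] := leqP j1 j; last first.
  apply: le_trans (kept_mass_le _) _.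
  have [kj|jk] := ltnP k (2 ^ j); last first.
    rewrite blkE big_seq_cond big1 ?mulr_ge0 ?addr_ge0 ?ltW // => z /andP[zs].
    by rewrite inE => /(Ik_lt (mu_torus zs)); rewrite ltnNge jk.
  have : eps * h j1 <= eps * h j by rewrite ler_wpM2l ?h_noninc ?(ltW eps_gt0) ?(ltnW jj1).
  have := mu_h k jJ; rewrite mulrDl mul1r.
  by have := coarse_cell (ltnW jj1) kj; rewrite ler_norml => /andP[]; lra.
have [none|] := pselect (forall z, z \in mu' -> ~ Ik (2 ^ j) k z.1).
  by rewrite mass0 // mulr_ge0 ?addr_ge0 ?ltW.
move=> /existsNP[z /not_implyP[/mapP[y + ->] /contrapT /= yk]].
rewrite mem_filter => /andP[/and3P[_ _ /allP ygood] ys].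
set i := last_tested h j1 (j - j1).
have /andP[j1i] : (j1 <= i <= j1 + (j - j1))%N := last_tested_bounds _ _ _.
rewrite subnKC // => ij.
set l := (k %/ 2 ^ (j - i))%N.
have ysub : Ik (2 ^ j) k `<=` (Ik (2 ^ i) l : set R) by exact: Ik_pow2.
have small : blk (wgt_gt i) (Ik (2 ^ i) l) c <= eps * h i.
  rewrite leNgt; apply/negP => bad.
  have : (i, l) \in bad_cells.
    rewrite mem_filter bad /=; apply/allpairsPdep; exists i, l; split=> //.
      by rewrite mem_filter tested_last mem_index_iota j1i ltnS (leq_trans ij).
    by rewrite mem_index_iota /=; apply: Ik_lt (mu_torus ys) (ysub _ yk).
  by move=> /ygood /negP; apply; rewrite inE; exact: ysub.
have hi : h i <= 2 * h j by have := last_tested_h j1 h_gt0 (j - j1); rewrite subnKC.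
have blk_le : blk (wgt_gt j) (Ik (2 ^ j) k) c <= blk (wgt_gt i) (Ik (2 ^ i) l) c.
  apply: ler_sum => n _; apply: ler_pM; rewrite ?mass_ge0 //.
    rewrite /wgt_gt; case: (ltnP j (lv n)) => jn; last by case: ifP.
    by rewrite (leq_ltn_trans ij jn).
  by apply: le_mass => // x xs [/ysub].
have : mass mu' (Ik (2 ^ j) k) <=
    \sum_(z <- mu | (z.1 \in Ik (2 ^ j) k) && (Z z.1 <= zeta)) z.2 * f z.1.
  rewrite mass_mu' big_mkcond [leRHS]big_mkcond big_seq [leRHS]big_seq.
  apply: ler_sum => x xs; have x0 : 0 <= x.2 * f x.1 by rewrite mulr_ge0 ?mu_ge0.
  rewrite /good; case: (Z x.1 <= zeta); rewrite ?andbF ?andbT //=.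
  by case: (_ \in _); rewrite ?andbF ?andbT //; case: ifP.
move=> le; apply: (le_trans le); apply: le_trans (bounded_overflow_le _ j1j) _.
have le2 := cell_overflow_le k (introT andP (conj j1j jJ)).
have e1 : eps * h i <= 2 * (eps * h j) by rewrite mulrCA ler_wpM2l // ltW.
have e2 : eps * h j <= 3^-1 * h j by rewrite ler_wpM2r.
have e3 : 0 < eps * h j by rewrite mulr_gt0.
by rewrite mulrDl mul1r; lra.
Qed.

(** The density [f] never exceeds the sum of all weights; this is where the constant [B]
    deteriorates. *)
Let kept_mass_g j k : (j <= J)%N ->
  mass mu' (Ik (2 ^ j) k) <= (\sum_n wgt n) * B * g j.
Proof.
move=> jJ; apply: le_trans (kept_mass_le _) _; rewrite blkE -mulrA.
have W0 : 0 <= \sum_n wgt n by apply: sumr_ge0.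
apply: le_trans (ler_wpM2l W0 (mu_g k jJ)); rewrite /mass mulr_sumr.
rewrite big_seq_cond [leRHS]big_seq_cond; apply: ler_sum => z /andP[/mu_ge0 z0 _].
rewrite mulrC ler_wpM2r //; apply: ler_sum => n _.
by rewrite ler_piMr // /ind; case: (_ \in _).
Qed.

Lemma stage_outcome : exists mu1 : seq (R * R), [/\ pos_mass mu1,
  forall z, z \in mu1 -> exists2 y, y \in mu & z.1 = y.1 /\
    exists2 n : 'I_N, (N0 <= n)%N & Ik (q n) (c n) z.1,
  forall j k, (j <= J)%N -> mass mu1 (Ik (2 ^ j) k) <= (1 + eps) * h j,
  forall j k, (j <= J)%N -> mass mu1 (Ik (2 ^ j) k) <= (\sum_n wgt n) * B * g j &
  mass mu setT - eps * (1 + h 0) <= mass mu1 setT].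
Proof.
exists mu'; split => //.
- move=> z /mapP[y]; rewrite mem_filter => /andP[_ ys] -> /=.
  by rewrite mulr_ge0 ?mu_ge0.
- move=> z /mapP[y]; rewrite mem_filter => /andP[/and3P[fy _ _] ys] -> /=.
  exists y => //; split => //.
  have [//|none] := pselect (exists2 n : 'I_N, (N0 <= n)%N & Ik (q n) (c n) y.1).
  move: fy; rewrite /f /dens big1 ?ltxx // => n _; rewrite /wgt /ind.
  case: ifP => [nN|]; last by rewrite mul0r.
  have [/set_mem yn|_] := boolP (_ \in _); last by rewrite mulr0.
  by case: none; exists n.
Qed.

End GoodOutcome.

End StageEstimate.

(** * Probability, under independence, that a block spoils the net content *)

Section StageProbability.
Variables (R : realType) (g h psi : nat -> R) (A : R).
Hypotheses (g_gt0 : forall j, 0 < g j) (h_gt0 : forall j, 0 < h j).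
Hypothesis psi_gt0 : forall j, 0 < psi j.
Hypothesis h_noninc : forall i j, (i <= j)%N -> h j <= h i.
Hypothesis psi_nondec : forall i j, (i <= j)%N -> psi i <= psi j.
Hypothesis gpsi_le : forall j, g j * psi j <= A * h j.
Variables (q lv : nat -> nat).
Hypothesis q_gt0 : forall n, (0 < q n)%N.
Hypothesis q_lv : forall n, (q n <= 2 ^ lv n < 2 * q n)%N.
Hypothesis gh_noninc : exists j0, forall i j, (j0 <= i <= j)%N -> g j / h j <= g i / h i.
Hypothesis gh_small : forall e, 0 < e -> exists j0, forall j, (j0 <= j)%N -> g j / h j <= e.
Hypothesis block_sum_large : forall N0 M, exists N, M <= block_sum psi q lv N0 N.

(* The net content of C, for the gauge min(h, B g), exceeds c: along the
   construction B deteriorates but c does not. *)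
Definition good_set (c : R) (C : set R) := exists B c', [/\ 0 < B, c < c' &
  forall L : seq (nat * nat),
    (forall x, C x -> torus x -> exists2 p, p \in L & Ik (2 ^ p.1) p.2 x) ->
    c' <= \sum_(p <- L) Num.min (h p.1) (B * g p.1)].

Definition block_set N0 N Q (u : {ffun 'I_N -> 'I_Q}) : set R :=
  [set x | exists2 n : 'I_N, (N0 <= n)%N & Ik (q n) (u n) x].

(** An outcome that spoils the content has a finite cheap cover. A Frostman measure on [C], built
    down to a level finer than all these covers, would after trimming be too heavy for such a cover
    if the badness were at most [eps]. So spoiling outcomes have badness above [eps], and Markov's
    inequality applies. *)
Lemma stage_probability c C N0 eta : 0 < c -> good_set c C -> 0 < eta ->
  exists N Q, (forall n, (n < N)%N -> (q n <= Q)%N) /\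
    \sum_(u : {ffun 'I_N -> 'I_Q} | `[< ~ good_set c (C `&` block_set N0 u) >])
      pmass (outcome_prob R q (Q:=Q)) u <= eta.
Proof.
move=> c0 [B [c' [B0 cc' CB]]] eta0.
have h0 := h_gt0 0.
have A0 : 0 <= A.
  by rewrite -(pmulr_lge0 _ h0); apply: le_trans (gpsi_le 0); rewrite mulr_ge0 ?ltW.
(* Trimming costs mass [eps * (1 + h 0)], and the bound for [h] worsens by the factor [1 + eps];
   [c''] is the content left after both losses, and [eps] is small enough to keep it above [c]. *)
set eps := Num.min 3^-1 ((c' - c) / (2 * (1 + h 0 + c))).
have D0 : 0 < 1 + h 0 + c by lra.
have eps0 : 0 < eps by rewrite lt_min invr_gt0 ltr0n divr_gt0 ?subr_gt0 // mulr_gt0.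
have eps3 : eps <= 3^-1 by rewrite ge_min lexx.
set c'' := (c' - eps * (1 + h 0)) / (1 + eps).
have eps1 : 0 < 1 + eps by lra.
have cc'' : c < c''.
  rewrite ltr_pdivlMr // mulrDr mulr1 mulrDr mulr1.
  have : eps <= (c' - c) / (2 * (1 + h 0 + c)) by rewrite ge_min lexx orbT.
  rewrite ler_pdivlMr ?mulr_gt0 // => e1.
  have : eps * (2 * (1 + h 0 + c)) = 2 * (eps + eps * h 0 + eps * c) by ring.
  have : c * eps = eps * c by rewrite mulrC.
  lra.
have [ja s_noninc] := gh_noninc.
(* The first bound ensures that [mu] is below half the threshold [eps * h j] on fine cells; the
   second makes the term with [s j1] in the mean badness at most [eps * eta / 2]. *)
set e := Num.min (eps / (2 * B)) (eps * eps * eta / (2 * h 0 * B)).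
have e0 : 0 < e by rewrite lt_min !divr_gt0 ?mulr_gt0.
have [jb s_small] := gh_small e0.
set j1 := maxn ja jb.
have {}s_noninc i j : (j1 <= i <= j)%N -> g j / h j <= g i / h i.
  by move=> /andP[a b]; apply: s_noninc; rewrite b andbT (leq_trans _ a) // leq_maxl.
have {}s_small j : (j1 <= j)%N -> g j / h j <= e.
  by move=> a; apply: s_small; rewrite (leq_trans _ a) // leq_maxr.
have s_small2 j : (j1 <= j)%N -> B * (g j / h j) <= eps / 2.
  move=> /s_small/le_trans/(_ (_ : e <= eps / (2 * B))).
  rewrite ge_min lexx => /(_ isT); rewrite ler_pdivlMr ?mulr_gt0 // => le.
  by rewrite ler_pdivlMr // (_ : _ * 2 = g j / h j * (2 * B)) //; ring.
(* [K] collects the terms of the mean badness that are divided by [block_sum]. It depends on [j1],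
   so the block is chosen after [j1]. *)
have [K KE] : exists K, K = h 0 * (A * B / eps + 48 * B * A / eps +
    3 * (j1.+1)%:R * B * A * h 0 / (eps * h j1 ^+ 2)) by eexists.
have K0 : 0 <= K.
  rewrite KE.
  have ie0 : 0 <= eps^-1 by rewrite invr_ge0 ltW.
  have he0 : 0 <= (eps * h j1 ^+ 2)^-1 by rewrite invr_ge0 mulr_ge0 ?sqr_ge0 // ltW.
  by rewrite mulr_ge0 ?addr_ge0 ?mulr_ge0 // ?ler0n // ltW.
have [N SN] := block_sum_large N0 (2 * K / (eps * eta) + 1).
set S := block_sum _ _ _ _ _ in SN.
have S0 : 0 < S.
  by apply: lt_le_trans SN; rewrite ltr_wpDl // divr_ge0 ?mulr_ge0 // ltW.
have KS : K / S <= eps * eta / 2.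
  have et0 : 0 < eps * eta by rewrite mulr_gt0.
  have : 2 * K / (eps * eta) <= S by apply: le_trans SN; rewrite lerDl.
  by rewrite !ler_pdivrMr //; lra.
set Q := (\max_(n < N) q n)%N.
have qQ n : (n < N)%N -> (q n <= Q)%N by move=> nN; exact: (leq_bigmax (Ordinal nN)).
exists N, Q; split => //.
set W := \sum_n wgt psi q lv N0 (n : 'I_N).
have W0 : 0 < W.
  rewrite lt_neqAle eq_sym sumr_ge0 ?andbT => [|n _]; last first.
    by rewrite /wgt; case: ifP => // _; rewrite divr_ge0 ?ltW.
  apply/negP => /eqP W0.
  have : 0 < (0 : R); last by rewrite ltxx.
  apply: (lt_le_trans S0); rewrite -(pmulr_lle0 _ (_ : 0 < S^-1)) ?invr_gt0 //.
  rewrite -W0 mulr_suml big_mkcond; apply: ler_sum => n _; rewrite /wgt; case: ifP => // _.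
  rewrite ler_wpM2r //; first by rewrite invr_ge0 ltW.
  rewrite ler_piMl //; first exact: ltW.
  by rewrite invf_le1 ?ltr0n // ler1n.
have bad_cover (u : {ffun 'I_N -> 'I_Q}) : exists L : seq (nat * nat),
    ~ good_set c (C `&` block_set N0 u) ->
    (forall x, (C `&` block_set N0 u) x -> torus x ->
       exists2 p, p \in L & Ik (2 ^ p.1) p.2 x) /\
    \sum_(p <- L) Num.min (h p.1) (W * B * g p.1) < c''.
  have [gd|bd] := pselect (good_set c (C `&` block_set N0 u)).
    by exists [::].
  have [L HL] : exists L : seq (nat * nat), ~ ((forall x, (C `&` block_set N0 u) x ->
      torus x -> exists2 p, p \in L & Ik (2 ^ p.1) p.2 x) ->
      c'' <= \sum_(p <- L) Num.min (h p.1) (W * B * g p.1)).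
    apply/existsNP => all; apply: bd; exists (W * B), c''.
    by split; first exact: mulr_gt0.
  exists L => _; move/not_implyP: HL => [? /negP]; rewrite -ltNge; by split.
have [L HL] := choice bad_cover.
(* There are finitely many outcomes, so one depth exceeds every level used in their covers; the
   measure [mu] is constructed only after this choice. *)
set J := maxn j1 (maxn (\max_(n < N) lv n)
  (\max_(u : {ffun 'I_N -> 'I_Q}) \max_(p <- L u) p.1)).
have lvJ n : (n < N)%N -> (lv n <= J)%N.
  move=> nN; rewrite /J leq_max; apply/orP; right; rewrite leq_max; apply/orP; left.
  exact: (leq_bigmax (Ordinal nN)).
have LJ u p : p \in L u -> (p.1 <= J)%N.
  move=> pL; rewrite /J leq_max; apply/orP; right; rewrite leq_max; apply/orP; right.
  apply: leq_trans (leq_bigmax u).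
  exact: (@leq_bigmax_seq _ (L u) xpredT (fun p => p.1)).
have j1J : (j1 <= J)%N by rewrite leq_maxl.
have a0 j : 0 <= Num.min (h j) (B * g j).
  by rewrite le_min !ltW // mulr_gt0.
have [mu [L0 [mu0 muC mua L0C L0s]]] :=
  dyadic_frostman_cell (J := J) C a0 (d := J) (j := 0) 0 (add0n J).
have muT z : z \in mu -> torus z.1.
  by move=> /muC [_]; rewrite expn0; exact: Ik_torus.
have muh j k : (j <= J)%N -> mass mu (Ik (2 ^ j) k) <= h j.
  by move=> jJ; apply: le_trans (mua j k _) _; rewrite ?ge_min ?lexx.
have mug j k : (j <= J)%N -> mass mu (Ik (2 ^ j) k) <= B * g j.
  by move=> jJ; apply: le_trans (mua j k _) _; rewrite ?ge_min ?lexx ?orbT.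
have mu_c' : c' <= mass mu setT.
  apply: le_trans L0s; apply: CB => x Cx xT; apply: L0C; split => //.
  by have [[|k] // _] := Ik_exists (isT : (0 < 1)%N) xT; rewrite expn0.
have mu_h0 : mass mu setT <= h 0.
  apply: le_trans (muh 0%N 0%N (leq0n _)); apply: le_mass => // z /muC [] //.
pose F := badness g h psi q lv N0 (N := N) (Q := Q) j1 J B eps mu.
have pr0 n k : 0 <= outcome_prob R q (Q:=Q) (N := N) n k.
  by rewrite /outcome_prob; case: ifP => // _; rewrite invr_ge0.
have F0 u : 0 <= F u by exact: badness_ge0.
have badF u : `[< ~ good_set c (C `&` block_set N0 u) >] -> eps < F u.
  move=> /asboolP /HL [cov small]; rewrite ltNge; apply/negP => Fu.
  have [mu1 [mu10 mu1C mu1h mu1g mu1s]] := stage_outcome g_gt0 h_gt0 psi_gt0 h_noninc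
    q_gt0 s_noninc B0 eps0 eps3 mu0 muT mug muh s_small2 S0 Fu.
  suff : mass mu1 setT < (1 + eps) * c''.
    rewrite /c'' mulrC divfK ?gt_eqF //; move: mu1s mu_c'; lra.
  apply: le_lt_trans (_ : (1 + eps) * \sum_(p <- L u) Num.min (h p.1) (W * B * g p.1) < _).
    rewrite mulr_sumr; apply: le_trans (mass_cover (A := setT) (L := L u)
        (B := fun p => Ik (2 ^ p.1) p.2) mu10 _) _.
      move=> z /mu1C[y ymu [zy [n nN zn]]] _; apply: cov.
        split; last by exists n.
        by rewrite zy; have [] := muC _ ymu.
      by rewrite zy; exact: muT.
    rewrite big_seq [leRHS]big_seq; apply: ler_sum => p /LJ pJ.
    have := mu1h _ p.2 pJ; have := mu1g _ p.2 pJ.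
    rewrite -/W; case: (leP (h p.1)) => // _ le _; apply: (le_trans le).
    by rewrite ler_peMl ?mulr_ge0 ?ltW // ltrDl.
  by rewrite ltr_pM2l.
apply: (@le_trans _ _ (\sum_(u | eps < F u) pmass (outcome_prob R q (Q:=Q)) u)).
  rewrite big_mkcond [leRHS]big_mkcond; apply: ler_sum => u _.
  case: ifP => [/badF -> //|_]; case: ifP => // _; exact: pmass_ge0.
apply: le_trans (pexp_markov pr0 F0 eps0) _.
rewrite ler_pdivrMr //.
apply: le_trans (badness_mean_le g_gt0 h_gt0 psi_gt0 h_noninc psi_nondec gpsi_le q_gt0 q_lv
  s_noninc qQ lvJ j1J B0 eps0 eps3 mu0 muT mug S0) _.
set E := (X in _ * X <= _).
have EE : h 0 * E = h 0 * (g j1 / h j1 * B / eps) + K / S.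
  rewrite /E KE -/S; field; rewrite !gt_eqF //.
have E0 : 0 <= E.
  have h'0 : 0 <= h 0 by exact: ltW.
  rewrite -(pmulr_rge0 _ h0) EE addr_ge0 ?divr_ge0 ?(ltW S0) //.
  by rewrite !mulr_ge0 // ?invr_ge0 ltW.
apply: le_trans (ler_wpM2r E0 mu_h0) _; rewrite EE.
have : h 0 * (g j1 / h j1 * B / eps) <= eps * eta / 2.
  have le1 : g j1 / h j1 <= eps * eps * eta / (2 * h 0 * B).
    by apply: le_trans (s_small _ (leqnn _)) _; rewrite ge_min lexx orbT.
  rewrite ler_pdivlMr ?mulr_gt0 // in le1.
  move: (g j1 / h j1) le1 => s le1.
  rewrite (_ : h 0 * _ = s * (2 * h 0 * B) / eps / 2); last by field; rewrite gt_eqF.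
  rewrite ler_pM2r ?invr_gt0 ?ltr0n // ler_pdivrMr //; lra.
move: KS; lra.
Qed.

End StageProbability.
(** * Transfer to the random variables *)

Lemma measure_bigsetU_le (R : realType) (d : measure_display) (T : measurableType d)
    (mu : {measure set T -> \bar R}) (I : Type) (s : seq I) (Q : pred I) (F : I -> set T) :
  (forall i, Q i -> measurable (F i)) ->
  (mu (\big[setU/set0]_(i <- s | Q i) F i) <= \sum_(i <- s | Q i) mu (F i))%E.
Proof.
move=> mF; elim: s => [|i s IH]; first by rewrite !big_nil measure0.
rewrite !big_cons; case: ifP => // Qi; apply: le_trans (leeD (lexx _) IH).
by apply: measureU2; [exact: mF | exact: bigsetU_measurable].
Qed.

Section AlmostSureStage.
Variables (R : realType) (d : measure_display) (Omega : measurableType d).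
Variables (P : probability Omega R) (X : nat -> Omega -> R) (r : nat -> R).
Hypothesis X_meas : forall n, measurable_fun [set: Omega] (X n).
Hypothesis X_torus : forall n w, torus (X n w).
Hypothesis X_unif : forall n (A : set R), measurable A ->
  P (X n @^-1` A) = lebesgue_measure (A `&` torus).
Hypothesis r01 : forall n, 0 < r n <= 1.
Hypothesis Theta_fin : (Theta_r P X r < +oo)%E.

Let q := qn r.

Lemma qn_bounds n : (0 < q n)%N /\ (r n)^-1 <= (q n)%:R < (r n)^-1 + 1.
Proof.
have /andP[r0 r1] := r01 n.
have i1 : 1 <= (r n)^-1 by rewrite invf_ge1.
have c1 : 0 < Num.ceil (r n)^-1 by rewrite ceil_gt0 invr_gt0.
have E : (q n)%:R = (Num.ceil (r n)^-1)%:~R :> R.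
  by rewrite -[in RHS](gtr0_norm c1) -abszE.
split; first by rewrite /q /qn absz_gt0 gt_eqF.
have /andP[a b] := ceil_itv (r n)^-1.
by rewrite E b /= -ltrBlDr -[X in _ - X](mulr1z 1) -rmorphB.
Qed.

Let q_gt0 n : (0 < q n)%N. Proof. by case: (qn_bounds n). Qed.

Lemma measurable_Ik a k : measurable (Ik a k : set R).
Proof.
rewrite (_ : Ik a k = `[k%:R / a%:R, k.+1%:R / a%:R[%classic) //.
Qed.

Lemma measurable_hit n k : measurable (X n @^-1` Ik (q n) k).
Proof.
by rewrite -[_ @^-1` _]setTI; apply: X_meas => //; exact: measurable_Ik.
Qed.

Lemma prob_hit n k : (k < q n)%N -> P (X n @^-1` Ik (q n) k) = ((q n)%:R^-1)%:E.
Proof.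
move=> kq; rewrite X_unif; last exact: measurable_Ik.
rewrite setIidl; last exact: Ik_torus.
rewrite (_ : Ik (q n) k = `[k%:R / (q n)%:R, k.+1%:R / (q n)%:R[%classic); last first.
  by apply/seteqP; split => x; rewrite /Ik /= in_itv.
rewrite lebesgue_measure_itv /= lte_fin ltr_pM2r ?invr_gt0 ?ltr0n // ltr_nat ltnSn.
by rewrite -EFinB -mulrBl -natrB // subSnn mul1r.
Qed.

Definition cylinder N Q (u : {ffun 'I_N -> 'I_Q}) : set Omega :=
  [set w | forall n : 'I_N, Ik (q n) (u n) (X n w)].

Lemma measurable_cylinder N Q (u : {ffun 'I_N -> 'I_Q}) : measurable (cylinder u).
Proof.
rewrite (_ : cylinder u = \bigcap_(n in [set: 'I_N]) (X n @^-1` Ik (q n) (u n))).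
  apply: fin_bigcap_measurable; first exact: finite_finset.
  by move=> n _; exact: measurable_hit.
by apply/seteqP; split => w H n => [_|]; apply: H.
Qed.

(** For a fixed sequence of cells the denominator in [theta] is the product of the [(q n)%:R^-1],
    that is, the mass of the outcome under the product law. *)
Lemma prob_cylinder_le : exists2 T : R, 0 <= T &
  forall N Q (u : {ffun 'I_N -> 'I_Q}),
    (P (cylinder u) <= (T * pmass (outcome_prob R q (Q:=Q)) u)%:E)%E.
Proof.
(* The maximum with 1 serves the empty block, since [theta] only involves blocks with at least one
   index. *)
set T := Num.max 1 (fine (Theta_r P X r)).
have T1 : 1 <= T by rewrite le_max lexx.
exists T; first by rewrite (le_trans ler01).
move=> N Q u.
have [un|] := pselect (forall n, (u n < q n)%N); last first.
  move=> /existsNP[n /negP]; rewrite -leqNgt => qu.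
  rewrite (_ : cylinder u = set0) ?measure0.
    rewrite lee_fin mulr_ge0 ?(le_trans ler01 T1) // prodr_ge0 // => i _.
    by rewrite /outcome_prob; case: ifP.
  by rewrite -subset0 => w /(_ n) /(Ik_lt (X_torus n w)); rewrite ltnNge qu.
have -> : pmass (outcome_prob R q (Q:=Q)) u = \prod_(n < N) (q n)%:R^-1.
  by apply: eq_bigr => n _; rewrite /outcome_prob un.
case: N u un => [|N] u un.
  rewrite big_ord0 mulr1; apply: le_trans (probability_le1 P (measurable_cylinder u)) _.
  by rewrite lee_fin.
(* [Theta_r] ranges over infinite sequences of cells: the finite outcome is continued by cells of
   index 0. *)
pose k n := if insub n is Some i then nat_of_ord (u i) else 0%N.
have ku (n : 'I_N.+1) : k n = u n.
  by rewrite /k; case: insubP => [i _ /val_inj -> //|]; rewrite ltn_ord.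
have kq n : (k n < q n)%N.
  rewrite /k; case: insubP => [i _ <- //|_]; exact: q_gt0.
have cylE : cylinder u = [set w | forall i, (i <= N)%N -> Ik (qn r i) (k i) (X i w)].
  apply/seteqP; split => w H.
    by move=> i iN; have := H (Ordinal (iN : (i < N.+1)%N)); rewrite -ku.
  by move=> n; rewrite -ku; apply: H; rewrite -ltnS.
have p0 : 0 < \prod_(n < N.+1) (q n)%:R^-1 :> R.
  by apply: prodr_gt0 => n _; rewrite invr_gt0 ltr0n.
have prodE : \prod_(i < N.+1) fine (P (X i @^-1` Ik (qn r i) (k i))) =
    \prod_(n < N.+1) (q n)%:R^-1.
  by apply: eq_bigr => n _; rewrite prob_hit.
have Pfin : P (cylinder u) \is a fin_num.
  exact: fin_num_measure (measurable_cylinder u).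
rewrite -(fineK Pfin) lee_fin -ler_pdivrMr // le_max; apply/orP; right.
have le_Theta : ((fine (P (cylinder u)) / \prod_(n < N.+1) (q n)%:R^-1)%:E <= Theta_r P X r)%E.
  apply: (@le_trans _ _ (theta P X (fun n => Ik (qn r n) (k n)))).
    by apply: ereal_sup_ubound; exists N => //; rewrite prodE cylE.
  by apply: ereal_sup_ubound; exists k.
rewrite -lee_fin fineK // ge0_fin_numE //; apply: le_trans le_Theta.
by rewrite lee_fin divr_ge0 ?fine_ge0 ?(ltW p0).
Qed.

Definition hit_set N0 N (w : Omega) : set R :=
  [set x | exists2 n, (N0 <= n < N)%N &
     exists2 k, Ik (q n) k x & Ik (q n) k (X n w)].

(** For every [m] some block fails with probability at most [T / m.+1], by comparison with the
    product law. Failure for all [N] implies failure for all these blocks, hence lies in a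
    measurable null set. *)
Lemma negligible_stage (g h psi : nat -> R) (A : R) (lv : nat -> nat) (c : R) (C : set R) (N0 : nat) :
  (forall j, 0 < g j) -> (forall j, 0 < h j) -> (forall j, 0 < psi j) ->
  (forall i j, (i <= j)%N -> h j <= h i) ->
  (forall i j, (i <= j)%N -> psi i <= psi j) ->
  (forall j, g j * psi j <= A * h j) ->
  (forall n, (q n <= 2 ^ lv n < 2 * q n)%N) ->
  (exists j0, forall i j, (j0 <= i <= j)%N -> g j / h j <= g i / h i) ->
  (forall e, 0 < e -> exists j0, forall j, (j0 <= j)%N -> g j / h j <= e) ->
  (forall N0 M, exists N, M <= block_sum psi q lv N0 N) ->
  0 < c ->
  P.-negligible [set w | good_set g h c C /\
     forall N, ~ good_set g h c (C `&` hit_set N0 N w)].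
Proof.
move=> g0 h0 psi0 hn psin gpsi qlv s_noninc s_small bs c0.
have [gC|nC] := pselect (good_set g h c C); last first.
  rewrite (_ : [set _ | _] = set0); first exact: negligible_set0.
  by rewrite -subset0 => w [].
have [T T0 PT] := prob_cylinder_le.
pose bad N Q (u : {ffun 'I_N -> 'I_Q}) := `[< ~ good_set g h c (C `&` block_set q N0 u) >].
have stage m : exists NQ : nat * nat, (forall n, (n < NQ.1)%N -> (q n <= NQ.2)%N) /\
    \sum_(u : {ffun 'I_NQ.1 -> 'I_NQ.2} | bad _ _ u)
      pmass (outcome_prob R q (Q:=NQ.2)) u <= m.+1%:R^-1.
  have m1 : 0 < m.+1%:R^-1 :> R by rewrite invr_gt0.
  have [N [Q H]] := stage_probability g0 h0 psi0 hn psin gpsi q_gt0 qlv s_noninc s_small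
    bs N0 c0 gC (m1 : 0 < m.+1%:R^-1 :> R).
  by exists (N, Q).
have [NQ HNQ] := choice stage.
pose E m := \big[setU/set0]_(u : {ffun 'I_(NQ m).1 -> 'I_(NQ m).2} | bad _ _ u) cylinder u.
have mE m : measurable (E m).
  by apply: bigsetU_measurable => u _; exact: measurable_cylinder.
exists (\bigcap_m E m); split.
- exact: bigcap_measurable.
- apply/eqP; rewrite eq_le measure_ge0 andbT; apply/lee_addgt0Pr => e e0; rewrite add0e.
  have [m Tm] : exists m : nat, T / m.+1%:R <= e.
    exists (Num.truncn (T / e)); rewrite ler_pdivrMr // mulrC -ler_pdivrMr //.
    by apply: ltW; have /andP[] := truncn_itv (divr_ge0 T0 (ltW e0)).
  have [_ sm] := HNQ m.
  apply: (@le_trans _ _ (P (E m))); first by apply: le_measure; rewrite ?inE //;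
    [exact: bigcap_measurable | exact: bigcap_inf].
  apply: (@le_trans _ _ (\sum_(u : {ffun 'I_(NQ m).1 -> 'I_(NQ m).2} | bad _ _ u) P (cylinder u))%E).
    apply: measure_bigsetU_le => u _; exact: measurable_cylinder.
  apply: (@le_trans _ _ (\sum_(u : {ffun 'I_(NQ m).1 -> 'I_(NQ m).2} | bad _ _ u)
      (T * pmass (outcome_prob R q (Q:=(NQ m).2)) u)%:E)%E).
    by apply: lee_sum => u _; exact: PT.
  rewrite sumEFin lee_fin -mulr_sumr; apply: le_trans Tm.
  by rewrite ler_wpM2l.
- move=> w [_ wbad] m _; have [qNQ _] := HNQ m.
  have H (n : 'I_(NQ m).1) : exists k : 'I_(NQ m).2, Ik (q n) k (X n w).
    have [k kq Xk] := Ik_exists (q_gt0 n) (X_torus n w).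
    by exists (Ordinal (leq_trans kq (qNQ _ (ltn_ord n)))).
  have [k Hk] := choice H.
  rewrite /E (bigD1 [ffun n => k n]) /=; first by left=> n; rewrite ffunE.
  apply/asboolP => gd; apply: (wbad (NQ m).1).
  suff <- : block_set q N0 [ffun n => k n] = hit_set N0 (NQ m).1 w by [].
  apply/seteqP; split => x.
    by move=> [n nN xn]; exists n; [rewrite nN ltn_ord | exists (k n); rewrite ?ffunE // in xn *].
  move=> [n /andP[nN nlt] [l xl Xl]]; exists (Ordinal nlt) => //; rewrite ffunE.
  by rewrite (Ik_inj (q_gt0 _) (Hk (Ordinal nlt)) Xl).
Qed.

End AlmostSureStage.
(** * Hausdorff contents on the torus *)

Section TorusGeometry.
Variable R : realType.
Implicit Types (x y : R) (U : set R).

Lemma tfrac_itv x : 0 <= tfrac x < 1.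
Proof.
have /andP[a b] := floor_itv x; rewrite /tfrac subr_ge0 a /= ltrBlDr.
by move: b; rewrite rmorphD /= addrC.
Qed.

Lemma tfrac_id x : torus x -> tfrac x = x.
Proof.
rewrite /torus /= in_itv /= => x01; rewrite /tfrac (_ : Num.floor x = 0) ?subr0 //.
by apply: floor_def; rewrite /= add0r.
Qed.

(** Together with [tdist_le_int], this identifies [tdist x y] with the minimum of [|x - y - m|] over
    the integers [m]. *)
Lemma tdist_int x y : exists m : int, tdist x y = `|x - y - m%:~R|.
Proof.
rewrite /tdist; have /andP[a b] := tfrac_itv (x - y).
case: leP => _.
  by exists (Num.floor (x - y)); rewrite ger0_norm.
exists (Num.floor (x - y) + 1); rewrite distrC ger0_norm.
  by rewrite /tfrac rmorphD /=; ring.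
by rewrite rmorphD /=; move: b; rewrite /tfrac; lra.
Qed.

Lemma tdist_le_int x y (m : int) : tdist x y <= `|x - y - m%:~R|.
Proof.
have /andP[a b] := tfrac_itv (x - y).
have E : x - y - m%:~R = tfrac (x - y) + (Num.floor (x - y) - m)%:~R.
  by rewrite /tfrac rmorphB /=; ring.
rewrite E /tdist; move: (tfrac _) (_ - m) a b => t n a b.
rewrite ge_min; have [n0|n0] := leP 0 n; apply/orP; [left|right].
  have : 0 <= n%:~R :> R by rewrite ler0z.
  by move=> ?; rewrite ger0_norm; lra.
have : n%:~R <= (-1)%:~R :> R by rewrite ler_int; lia.
by rewrite mulrN1z => n1; rewrite ler0_norm; lra.
Qed.

Lemma tdist_ge0 x y : 0 <= tdist x y.
Proof. by have [m ->] := tdist_int x y. Qed.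

Lemma tdist_le x y : tdist x y <= `|x - y|.
Proof. by have := tdist_le_int x y 0; rewrite subr0. Qed.

Lemma tdist_perturb x y x' y' : tdist x' y' <= tdist x y + `|x' - x| + `|y' - y|.
Proof.
have [m ->] := tdist_int x y; apply: le_trans (tdist_le_int _ _ m) _.
rewrite (_ : x' - y' - m%:~R = (x - y - m%:~R) + (x' - x) - (y' - y)); last by ring.
by apply: le_trans (ler_normB _ _) _; rewrite lerD2r ler_normD.
Qed.

Lemma tdiam_ub U x y : U x -> U y -> tdist x y <= tdiam U.
Proof.
move=> Ux Uy; apply: ub_le_sup; last by exists x => //; exists y.
exists 1 => _ [a _ [b _ <-]]; rewrite /tdist ge_min.
by have /andP[_ /ltW ->] := tfrac_itv (a - b).
Qed.

Lemma tdiam_le U e : 0 <= e -> (forall x y, U x -> U y -> tdist x y <= e) -> tdiam U <= e.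
Proof.
move=> e0 He; rewrite /tdiam; set S := (X in sup X).
have [->|/set0P S0] := eqVneq S set0; first by rewrite sup0.
by apply: ge_sup => // _ [x Ux [y Uy <-]]; exact: He.
Qed.

Lemma tdiam_ge0 U : 0 <= tdiam U.
Proof.
have [->|/set0P[x Ux]] := eqVneq U set0; last exact: le_trans (tdist_ge0 x x) (tdiam_ub Ux Ux).
rewrite /tdiam (_ : [set tdist x y | x in set0 & y in set0] = set0) ?sup0 //.
by rewrite -subset0 => z [? []].
Qed.

Lemma tdiam_Ik j k : tdiam (Ik (2 ^ j) k : set R) <= 2 ^- j.
Proof.
apply: tdiam_le => [|x y xk yk]; first by rewrite invr_ge0 exprn_ge0.
by apply: le_trans (tdist_le _ _) _; rewrite -natrX ltW //; exact: Ik_near xk yk.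
Qed.

Lemma pow2V_small (e : R) : 0 < e -> exists j, 2 ^- j <= e.
Proof.
move=> e0; exists (Num.truncn e^-1); rewrite -[leRHS]invrK lef_pV2 ?posrE ?invr_gt0 ?exprn_gt0 //.
have ei : 0 <= e^-1 by rewrite invr_ge0 ltW.
have /andP[_ /ltW le] := truncn_itv ei; apply: (le_trans le).
by rewrite -natrX ler_nat ltn_expl.
Qed.

(** The points are less than two cell lengths apart on the circle, so the indices of their cells
    differ by at most 2 modulo [2 ^ j]; [i] runs over the five possibilities, shifted by 2. *)
Lemma tdist_cells j k l x y : (0 < j)%N -> (l < 2 ^ j)%N ->
  Ik (2 ^ j) k x -> Ik (2 ^ j) l y -> tdist x y < 2 ^- j.-1 ->
  exists2 i, (i < 5)%N & l = `|((k%:Z + i%:Z - 2) %% (2 ^ j)%:Z)%Z|%N.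
Proof.
case: j => // j _ lj.
have p0 : (0 < 2 ^ j.+1)%N by rewrite expn_gt0.
have pR : 0 < (2 ^ j.+1)%:R :> R by rewrite ltr0n.
move=> /(in_Ik _ _ p0) xk /(in_Ik _ _ p0) yl /=; have [m ->] := tdist_int x y => d.
have {}d : `|(2 ^ j.+1)%:R * x - (2 ^ j.+1)%:R * y - (2 ^ j.+1)%:R * m%:~R| < 2.
  rewrite -!mulrBr normrM gtr0_norm // mulrC -ltr_pdivlMr //.
  by apply: lt_le_trans d _; rewrite expnS natrM natrX invfM mulrA divff ?mul1r.
have : `|(k%:Z - l%:Z - (2 ^ j.+1)%:Z * m)%:~R : R| < 3%:Z%:~R.
  rewrite !rmorphB /= rmorphM /= -!pmulrn; move: d xk yl; rewrite !ltr_norml.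
  set a := _ * x; set b := _ * y; set M := _ * m%:~R.
  by rewrite -!natr1 => /andP[d1 d2] /andP[x1 x2] /andP[y1 y2]; apply/andP; split; lra.
rewrite -intr_norm ltr_int => d'.
exists (absz (l%:Z - k%:Z + (2 ^ j.+1)%:Z * m + 2)%R); first by lia.
rewrite gez0_abs; last by lia.
rewrite (_ : _ - 2 = m * (2 ^ j.+1)%:Z + l%:Z); last by ring.
by rewrite modzMDl modz_small ?absz_nat.
Qed.

(** Take the least [j] with [2 ^- j <= e]. If [j] is positive, [e] is less than two cell lengths,
    and five cells of level [j] around any point of [V] suffice. *)
Lemma small_set_cover (h : R -> R) (V : set R) (e : R) : gauge h -> 0 < e ->
  V `<=` torus -> (forall x y, V x -> V y -> tdist x y <= e) ->
  exists L : seq (nat * nat),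
    (forall x, V x -> exists2 p, p \in L & Ik (2 ^ p.1) p.2 x) /\
    \sum_(p <- L) h (2 ^- p.1) <= 5 * h e.
Proof.
move=> [hm [_ [_ hpos]]] e0 VT Ve; have he := hpos _ e0.
have [[x0 Vx0]|V0] := pselect (exists x, V x); last first.
  exists [::]; split => [x Vx|]; first by case: V0; exists x.
  by rewrite big_nil mulr_ge0 // ltW.
have ex : exists j, 2 ^- j <= e by exact: pow2V_small.
case: (ex_minnP ex) => j je jmin.
have hj : h (2 ^- j) <= h e.
  by apply: hm => //; rewrite in_itv /= andbT ?invr_ge0 ?exprn_ge0 // ltW.
have [j0|j0] := posnP j.
  exists [:: (0, 0)%N]; split => [x /VT xT|]; last first.
    by rewrite big_seq1 /=; move: hj; rewrite j0; lra.
  exists (0, 0)%N; rewrite ?inE //.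
  by have [[|k] // _] := Ik_exists (isT : (0 < 1)%N) xT; rewrite expn0.
have p0 : (0 < 2 ^ j)%N by rewrite expn_gt0.
have [k kj x0k] := Ik_exists p0 (VT _ Vx0).
exists [seq (j, `|((k%:Z + i%:Z - 2) %% (2 ^ j)%:Z)%Z|%N) | i <- iota 0 5]; split; last first.
  by rewrite big_map /= !big_cons big_nil /=; move: hj; lra.
move=> x Vx; have [l lj xl] := Ik_exists p0 (VT _ Vx).
have [|i i5 lE] := tdist_cells j0 lj x0k xl.
  apply: le_lt_trans (Ve _ _ Vx0 Vx) _; rewrite ltNge; apply/negP => /jmin.
  by rewrite leqNgt prednK ?leqnn.
exists (j, l) => //; apply/mapP; exists i; rewrite ?mem_iota //.
by rewrite lE.
Qed.

End TorusGeometry.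

(** * Positive Hausdorff measure of a decreasing intersection *)

Section LimitSet.
Variables (R : realType) (h : R -> R).
Hypothesis h_gauge : gauge h.

(** Right continuity lets covering sets be enlarged to open ones at an arbitrarily small cost in
    [h]. *)
Lemma gauge_right_approx a e : 0 <= a -> 0 < e ->
  exists2 t, 0 < t & h (a + t) <= h a + e.
Proof.
have [_ [hc _]] := h_gauge; move=> a0 e0; have /cvgrPdist_lt /(_ e e0) := hc a a0.
rewrite near_withinE => -[d /= d0 H]; exists (d / 2); first by rewrite divr_gt0.
have : `|h a - h (a + d / 2)| < e.
  apply: H => /=; last by rewrite ltrDl divr_gt0.
  by rewrite opprD addrA subrr sub0r normrN gtr0_norm ?divr_gt0 //; lra.
by rewrite ltr_norml => /andP[]; lra.
Qed.

Lemma sum_half_lt n : \sum_(i < n) 2 ^- i.+1 < 1 :> R.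
Proof.
suff -> : \sum_(i < n) 2 ^- i.+1 = 1 - 2 ^- n :> R.
  by rewrite ltrBlDr ltrDl invr_gt0 exprn_gt0.
elim: n => [|n IH]; first by rewrite big_ord0 expr0 invr1 subrr.
by rewrite big_ord_recr /= IH exprS invfM; lra.
Qed.

(** A cheap cover of [E], made open and completed by tiny balls around the exceptional points
    [dd i], covers the intersection. By compactness finitely many of these sets cover some [K M],
    and replacing them by dyadic cells contradicts the lower bound [c]. *)
Lemma hausdorff_limit_gt0 (K : nat -> set R) (c : R) (dd : nat -> R) (E : set R) :
  0 < c -> (forall t, compact (K t)) -> (forall t, K t.+1 `<=` K t) ->
  (forall t (L : seq (nat * nat)),
     (forall x, K t x -> torus x -> exists2 p, p \in L & Ik (2 ^ p.1) p.2 x) ->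
     c <= \sum_(p <- L) h (2 ^- p.1)) ->
  (forall x, (forall t, K t x) -> (exists i, x = dd i) \/ E x) ->
  (0 < hausdorff h E)%E.
Proof.
move=> c0 Kc Kd Kcov KE; rewrite ltNge; apply/negP => H0.
have h0 : h 0 = 0 by case: h_gauge => _ [_ []].
have h_ge0 x : 0 <= x -> 0 <= h x.
  by rewrite le_eqVlt => /orP[/eqP <-|/(h_gauge.2.2.2)/ltW //]; rewrite h0.
(* Dyadic cells cost a factor 5, and the errors [e i] enter once for [V i] and once for [W i]; the
   total stays below [(5 + 10) * (c / 20) < c]. *)
have : (hcontent h 1 E < (c / 20)%:E)%E.
  apply: (@le_lt_trans _ _ (hausdorff h E)).
    by apply: ereal_sup_ubound; exists 1 => //=; rewrite in_itv /= ltr01.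
  by apply: (le_lt_trans H0); rewrite lte_fin divr_gt0.
move=> /ereal_inf_lt[_ [U [UT [_ EU]] <-] sumU].
pose e i : R := c / 20 * 2 ^- i.+1.
have e0 i : 0 < e i by rewrite mulr_gt0 ?divr_gt0 ?invr_gt0 ?exprn_gt0.
have [eta Heta] : {eta : nat -> R & forall i, 0 < eta i /\
    h (tdiam (U i) + eta i) <= h (tdiam (U i)) + e i}.
  apply: (@choice _ _ (fun i t => 0 < t /\ h (tdiam (U i) + t) <= h (tdiam (U i)) + e i)) => i.
  have [t t0 ht] := gauge_right_approx (tdiam_ge0 (U i)) (e0 i).
  by exists t.
have [zeta Hzeta] : {zeta : nat -> R & forall i, 0 < zeta i /\ h (zeta i) <= e i}.
  apply: (@choice _ _ (fun i t => 0 < t /\ h t <= e i)) => i; have [t t0 ht] := gauge_right_approx (lexx 0) (e0 i).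
  by exists t; move: ht; rewrite !add0r h0 add0r.
pose V i := \bigcup_(x in U i) ball x (eta i / 2).
pose W i : set R := ball (dd i) (zeta i / 2).
(* The complements of the [K i] complete an open cover of [K 0]; on [K M], with [M] the largest
   index of a finite subcover, they contribute nothing. *)
pose O i := V i `|` W i `|` ~` K i.
have KO : K 0%N `<=` \bigcup_i O i.
  move=> x Kx; have [all|/existsNP[t nt]] := pselect (forall t, K t x); last first.
    by exists t => //; right.
  case: (KE _ all) => [[i ->]|/EU[i _ Ux]].
    exists i => //; left; right; apply: ballxx; have [z _] := Hzeta i.
    by rewrite divr_gt0.
  exists i => //; left; left; exists x => //; apply: ballxx; have [z _] := Heta i.
  by rewrite divr_gt0.
have Oopen i : open (O i).
  apply: openU; first apply: openU.
  - by apply: bigcup_open => x _; exact: ball_open.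
  - exact: ball_open.
  - rewrite openC; apply: compact_closed => //; exact: Rhausdorff.
have := Kc 0%N; rewrite compact_cover => /(_ nat setT O (fun i _ => Oopen i) KO)[D _ DO].
pose M := (\max_(i <- finmap.enum_fset D) i)%N.
have Kmono t i : (i <= t)%N -> K t `<=` K i.
  elim: t => [|t IH]; first by rewrite leqn0 => /eqP ->.
  rewrite leq_eqVlt => /orP[/eqP -> //|it]; apply: subset_trans (Kd t) _; exact: IH.
have KM x : K M x -> exists2 i, (i <= M)%N & V i x \/ W i x.
  move=> KMx; have [i /= iD [VW|nK]] := DO x (Kmono M 0%N (leq0n _) _ KMx).
    exists i => //; exact: (leq_bigmax_seq i).
  by case: nK; apply: Kmono KMx; exact: (leq_bigmax_seq i).
have LV i : exists L : seq (nat * nat),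
    (forall x, (V i `&` torus) x -> exists2 p, p \in L & Ik (2 ^ p.1) p.2 x) /\
    \sum_(p <- L) h (2 ^- p.1) <= 5 * h (tdiam (U i) + eta i).
  have [t0 _] := Heta i.
  apply: small_set_cover => //; first by rewrite ltr_wpDl // tdiam_ge0.
  move=> x y [[x' Ux' /= bx] _] [[y' Uy' /= by'] _].
  apply: le_trans (tdist_perturb x' y' x y) _; rewrite -addrA; apply: lerD.
    exact: tdiam_ub.
  by move: bx by'; rewrite -!ball_normE /= (distrC x) (distrC y); lra.
have LW i : exists L : seq (nat * nat),
    (forall x, (W i `&` torus) x -> exists2 p, p \in L & Ik (2 ^ p.1) p.2 x) /\
    \sum_(p <- L) h (2 ^- p.1) <= 5 * h (zeta i).
  have [t0 _] := Hzeta i; apply: small_set_cover => //.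
  move=> x y [bx _] [by' _]; apply: le_trans (tdist_perturb (dd i) (dd i) x y) _.
  have -> : tdist (dd i) (dd i) = 0.
    by apply/eqP; rewrite eq_le tdist_ge0 andbT (le_trans (tdist_le _ _)) // subrr normr0.
  by move: bx by'; rewrite /W -!ball_normE /= (distrC x) (distrC y); lra.
have [lv Hlv] := choice LV; have [lw Hlw] := choice LW.
have := Kcov M (flatten [seq lv i ++ lw i | i <- iota 0 M.+1]).
have cov x : K M x -> torus x -> exists2 p,
    p \in flatten [seq lv i ++ lw i | i <- iota 0 M.+1] & Ik (2 ^ p.1) p.2 x.
  move=> /KM[i iM VW] xT.
  have [p pi xp] : exists2 p, p \in lv i ++ lw i & Ik (2 ^ p.1) p.2 x.
    case: VW => Hx.
      by have [p pl xp] := (Hlv i).1 x (conj Hx xT); exists p => //; rewrite mem_cat pl.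
    by have [p pl xp] := (Hlw i).1 x (conj Hx xT); exists p => //; rewrite mem_cat pl orbT.
  exists p => //; apply/flattenP; exists (lv i ++ lw i) => //.
  by apply/mapP; exists i => //; rewrite mem_iota.
move=> /(_ cov); apply/negP; rewrite -ltNge big_flatten big_map.
apply: (@le_lt_trans _ _ (\sum_(0 <= i < M.+1) (5 * h (tdiam (U i)) + 10 * e i))).
  rewrite /index_iota subn0; apply: ler_sum => i _; rewrite big_cat /=.
  have [_ ?] := Heta i; have [_ ?] := Hzeta i.
  by have [_ ?] := Hlv i; have [_ ?] := Hlw i; lra.
rewrite big_split -!mulr_sumr.
have s1 : \sum_(0 <= i < M.+1) h (tdiam (U i)) <= c / 20.
  rewrite -lee_fin -sumEFin; apply: le_trans (ltW sumU).
  by apply: nneseries_lim_ge => i _ _; rewrite lee_fin h_ge0 // tdiam_ge0.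
have s2 : \sum_(0 <= i < M.+1) 2 ^- i.+1 < 1 :> R by rewrite big_mkord sum_half_lt.
set s := \sum_(0 <= i < M.+1) 2 ^- i.+1 in s2 *.
have : c / 20 * s <= c / 20 by rewrite ler_piMr ?divr_ge0 // ltW.
by move: s1 => /=; lra.
Qed.

End LimitSet.

(** * Series and dyadic net contents *)

Section Preliminaries.
Variable R : realType.

Lemma nneseries_ub (u : nat -> R) m M : (forall n, 0 <= u n) ->
  (forall n, \sum_(m <= i < n) u i <= M) ->
  (\sum_(m <= i <oo) (u i)%:E <= M%:E)%E.
Proof.
move=> u0 uM; apply: lime_le; first by apply: is_cvg_nneseries => n _ _; rewrite lee_fin.
by apply: nearW => n; rewrite sumEFin lee_fin.
Qed.

(* Abel summation on the monotone tail of s. *)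
Lemma bounded_of_increments (s psi : nat -> R) (j0 : nat) (M : R) :
  (forall j, 0 <= s j) -> (forall j, 0 <= psi j) ->
  (forall i j, (i <= j)%N -> psi i <= psi j) ->
  (forall i j, (j0 <= i <= j)%N -> s j <= s i) ->
  (forall n, \sum_(1 <= i < n) s i * (psi i - psi i.-1) <= M) ->
  exists A, forall j, s j * psi j <= A.
Proof.
move=> s0 psi0 psin sn sM; exists (M + \sum_(0 <= i < j0.+1) s i * psi i) => j.
have M0 : 0 <= M by have := sM 0%N; rewrite big_geq.
have t0 i : 0 <= s i * psi i by rewrite mulr_ge0.
have le_sum i : (i <= j0)%N -> s i * psi i <= \sum_(0 <= i < j0.+1) s i * psi i.
  move=> ij; rewrite (bigD1_seq i) ?iota_uniq ?mem_index_iota ?ltnS //=.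
  by rewrite lerDl sumr_ge0.
have [jj0|j0j] := leqP j j0; first by apply: le_trans (le_sum _ jj0) _; rewrite lerDr.
have inc : s j * (psi j - psi j0) <= M.
  apply: le_trans (sM j.+1); rewrite (big_cat_nat _ (n := j0.+1)) //=; last by lia.
  apply: ler_wpDl.
    by apply: sumr_ge0 => i _; rewrite mulr_ge0 // subr_ge0 psin // leq_pred.
  rewrite -(telescope_sumr _ (ltnW j0j)) mulr_sumr big_add1 /=.
  rewrite big_nat_cond [leRHS]big_nat_cond; apply: ler_sum => i /andP[/andP[a b] _].
  by rewrite ler_wpM2r ?subr_ge0 ?psin // sn // (leqW a) b.
have := le_sum _ (leqnn j0).
have : s j * psi j0 <= s j0 * psi j0 by rewrite ler_wpM2r // sn // leqnn ltnW.
by move: inc; rewrite mulrBr; lra.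
Qed.

(** A dyadic cover either contains a cell coarser than level [j0], which alone costs [g (2 ^- j0)],
    or consists of cells small enough to compete in [hcontent g delta]. *)
Lemma net_content_gt0 (g : R -> R) (G : set R) : gauge g -> G `<=` torus -> (0 < hausdorff g G)%E ->
  exists2 c, 0 < c & forall L : seq (nat * nat),
    (forall x, G x -> exists2 p, p \in L & Ik (2 ^ p.1) p.2 x) ->
    c <= \sum_(p <- L) g (2 ^- p.1).
Proof.
move=> [gm [_ [g0 gpos]]] GT /ereal_sup_gt[_ [delta + <-] C0].
rewrite /= in_itv /= andbT => d0.
have [j0 j0d] := pow2V_small d0.
have pow0 j : 0 < 2 ^- j :> R by rewrite invr_gt0 exprn_gt0.
have pow_le i j : (i <= j)%N -> 2 ^- j <= 2 ^- i :> R.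
  by move=> ij; rewrite lef_pV2 ?posrE ?exprn_gt0 // ler_eXn2l // ltr1n.
have gle x y : 0 <= x -> x <= y -> g x <= g y.
  by move=> x0 xy; apply: gm => //; rewrite in_itv /= andbT // (le_trans x0).
have [c1 c10 c1C] : exists2 c1 : R, 0 < c1 & (c1%:E <= hcontent g delta G)%E.
  case: (hcontent g delta G) C0 => [x| |] //= x0; last by exists 1; rewrite ?leey.
  by exists x; rewrite -?lte_fin.
exists (Num.min c1 (g (2 ^- j0))); first by rewrite lt_min c10 gpos.
move=> L GL; rewrite ge_min.
have sum_ge0 (s : seq (nat * nat)) : 0 <= \sum_(p <- s) g (2 ^- p.1).
  by apply: sumr_ge0 => p _; rewrite ltW // gpos.
have [/allP big|/allPn[p pL]] := boolP (all (fun p => (j0 <= p.1)%N) L); last first.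
  rewrite -ltnNge => pj; apply/orP; right; rewrite (big_rem p) //= ler_wpDr //.
  by apply: gle; [exact: ltW | apply: pow_le; exact: ltnW].
apply/orP; left; rewrite -lee_fin; apply: (le_trans c1C).
(* The finite cover is padded with empty sets, whose diameter is 0, where [g] vanishes. *)
pose U i : set R := if (i < size L)%N then
  Ik (2 ^ (nth (0, 0)%N L i).1) (nth (0, 0)%N L i).2 `&` torus else set0.
have U0 i : (size L <= i)%N -> tdiam (U i) = 0.
  rewrite leqNgt /U => /negPf ->; apply/eqP; rewrite eq_le tdiam_ge0 andbT.
  by apply: tdiam_le.
have Ud i : (i < size L)%N -> tdiam (U i) <= 2 ^- (nth (0, 0)%N L i).1.
  move=> iL; apply: le_trans (tdiam_Ik R (nth (0, 0)%N L i).1 (nth (0, 0)%N L i).2).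
  apply: tdiam_le; first exact: tdiam_ge0.
  by move=> x y; rewrite /U iL => -[xU _] [yU _]; exact: tdiam_ub.
have gU i : 0 <= g (tdiam (U i)) by rewrite -g0 gle // tdiam_ge0.
apply: (@le_trans _ _ (\sum_(0 <= i <oo) (g (tdiam (U i)))%:E)%E).
  apply: ereal_inf_lbound; exists U => //; split; [|split].
  - by move=> i x; rewrite /U; case: ifP => // _ [].
  - move=> i; have [iL|Li] := ltnP i (size L); last by rewrite U0 // ltW.
    apply: le_trans (Ud i iL) _; apply: le_trans (pow_le _ _ _) j0d.
    by apply: big; rewrite mem_nth.
  - move=> x Gx; have [p pL xp] := GL x Gx; exists (index p L) => //.
    by rewrite /U index_mem pL nth_index //; split; [|exact: GT].
apply: nneseries_ub => // n.
have e : \sum_(0 <= i < maxn n (size L)) g (tdiam (U i)) <= \sum_(p <- L) g (2 ^- p.1).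
  rewrite (big_cat_nat _ (n := size L)) ?leq_maxr //=.
  rewrite [X in _ + X]big_nat_cond [X in _ + X]big1 ?addr0; last first.
    by move=> i /andP[/andP[Li _] _]; rewrite U0.
  rewrite (big_nth (0, 0)%N) big_nat_cond [leRHS]big_nat_cond.
  by apply: ler_sum => i /andP[/andP[_ iL] _]; apply: gle; [exact: tdiam_ge0 | exact: Ud].
apply: le_trans e; rewrite [leRHS](big_cat_nat _ (n := n)) ?leq_maxl //=.
by rewrite lerDl sumr_ge0.
Qed.

Lemma unbounded_tail (u v : nat -> R) N0 M : (forall n, 0 <= u n) -> (forall n, 0 <= v n) ->
  (forall n, u n <= 2 * v n) -> (\sum_(0 <= n <oo) (u n)%:E = +oo)%E ->
  exists N, M <= \sum_(n < N | (N0 <= n)%N) v n.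
Proof.
move=> u0 v0 uv div; apply: contrapT => /forallNP none.
suff : (\sum_(0 <= n <oo) (u n)%:E <= (2 * (M + \sum_(0 <= n < N0) v n))%:E)%E.
  by rewrite div leNgt ltey.
apply: nneseries_ub => // n.
apply: (@le_trans _ _ (2 * \sum_(0 <= i < maxn n N0) v i)).
  apply: (@le_trans _ _ (\sum_(0 <= i < maxn n N0) u i)).
    by rewrite [leRHS](big_cat_nat _ (n := n)) ?leq_maxl //= lerDl sumr_ge0.
  by rewrite mulr_sumr; apply: ler_sum => i _; exact: uv.
rewrite ler_wpM2l // (big_cat_nat _ (n := N0)) ?leq_maxr //= addrC lerD2r.
have /negP := none (maxn n N0); rewrite -ltNge => /ltW; apply: le_trans.
rewrite big_nat_cond -(big_mkord (fun i => N0 <= i)%N) big_nat_cond.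
rewrite [leRHS]big_mkcond [leRHS](big_cat_nat _ (n := N0)) ?leq_maxr //=.
rewrite ler_wpDl //; first by apply: sumr_ge0 => i _; case: ifP.
rewrite big_mkcond big_nat_cond [leRHS]big_nat_cond; apply: ler_sum => i.
by rewrite andbT => /andP[a b]; rewrite a b.
Qed.

End Preliminaries.
(** * The random Cantor construction *)

Section CantorSets.
Variables (R : realType) (q : nat -> nat) (K0 : set R).
Hypothesis K0_compact : compact K0.

(** Cells are closed up to keep the sets compact; the added right endpoints form a countable set. *)
Definition closed_cell (p : nat * nat) : set R :=
  `[p.2%:R / (q p.1)%:R, p.2.+1%:R / (q p.1)%:R]%classic.

(** The sets are indexed by finite lists of cells, a countable type independent of the random
    point. *)
Fixpoint cantor_set (s : seq (seq (nat * nat))) : set R :=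
  if s is b :: s' then cantor_set s' `&` \big[setU/set0]_(p <- b) closed_cell p
  else K0.

Lemma cantor_set_compact s : compact (cantor_set s).
Proof.
elim: s => [|b s IH] //=; apply: compact_closedI => //.
by apply: closed_bigsetU => p _; exact: interval_closed.
Qed.

Lemma good_set_sub (g h : nat -> R) c (C D : set R) :
  C `&` torus `<=` D -> good_set g h c C -> good_set g h c D.
Proof.
move=> CD [B [c' [B0 cc' H]]]; exists B, c'; split => // L DL; apply: H => x Cx xT.
by apply: DL => //; exact: CD.
Qed.

End CantorSets.

Theorem theorem3p3 (R : realType) (d : measure_display) (Omega : measurableType d)
  (P : probability Omega R) (X : nat -> Omega -> R) (r : nat -> R)
  (G : set R) (g h phi : R -> R) :
  (* each X_n is a random variable in T = [0,1), distributed by Lebesgue measure *)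
  (forall n, measurable_fun [set: Omega] (X n)) ->
  (forall n w, torus (X n w)) ->
  (forall n (A : set R), measurable A ->
     P (X n @^-1` A) = lebesgue_measure (A `&` torus)) ->
  (forall n, 0 < r n <= 1) ->
  (* G nonempty compact subset of T *)
  G `<=` torus -> G !=set0 -> closed [set x : R | G (tfrac x)] ->
  gauge g -> (0 < hausdorff g G)%E ->
  gauge h -> gauge phi -> gauge_prec phi h g ->
  (Theta_r P X r < +oo)%E ->
  (\sum_(0 <= n <oo) (r n / phi (r n))%:E = +oo)%E ->
  {ae P, forall w, (0 < hausdorff h (limsup_set X r w `&` G))%E}.
Proof.
move=> X_meas X_torus X_unif r01 GT G0 Gclosed gg gG hh pp [[eps0 eps00 s_mono] [s_lim s_sum]] Th div.
have [gm [_ [g0 gpos]]] := gg; have [hm [_ [h0 hpos]]] := hh; have [pm [_ [p0 ppos]]] := pp.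
pose q := qn r; pose lv n := up_log 2 (q n).
have q_bounds n : (0 < q n)%N /\ (r n)^-1 <= (q n)%:R < (r n)^-1 + 1 by exact: qn_bounds.
have q0 n : (0 < q n)%N by case: (q_bounds n).
have q_lv n : (q n <= 2 ^ lv n < 2 * q n)%N.
  rewrite /lv up_logP //=; have := q0 n; rewrite leq_eqVlt => /orP[/eqP <- //|q1].
  have /andP[a _] := up_log_bounds (isT : (1 < 2)%N) q1.
  have lv0 : (0 < up_log 2 (q n))%N by rewrite up_log_gt0.
  by rewrite -(prednK lv0) expnS ltn_pmul2l.
have pow0 j : 0 < 2 ^- j :> R by rewrite invr_gt0 exprn_gt0.
have pow_le i j : (i <= j)%N -> 2 ^- j <= 2 ^- i :> R.
  by move=> ij; rewrite lef_pV2 ?posrE ?exprn_gt0 // ler_eXn2l // ltr1n.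
have mono (f : R -> R) : {in `[0, +oo[ &, {homo f : x y / x <= y}} ->
    forall x y, 0 <= x -> x <= y -> f x <= f y.
  by move=> fm x y x0 xy; apply: fm => //; rewrite in_itv /= andbT // (le_trans x0).
pose gj j := g (2 ^- j); pose hj j := h (2 ^- j); pose psi j := (phi (2 ^- j))^-1.
have gj0 j : 0 < gj j by exact: gpos.
have hj0 j : 0 < hj j by exact: hpos.
have psi0 j : 0 < psi j by rewrite invr_gt0 ppos.
have hjn i j : (i <= j)%N -> hj j <= hj i by move=> /pow_le; apply: mono => //; exact: ltW.
have psin i j : (i <= j)%N -> psi i <= psi j.
  move=> /pow_le ij; rewrite lef_pV2 ?posrE ?ppos //.
  by apply: mono ij => //; exact: ltW.
have s_noninc : exists j0, forall i j, (j0 <= i <= j)%N -> gj j / hj j <= gj i / hj i.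
  have [j0 j0e] := pow2V_small eps00; exists j0 => i j /andP[a b].
  have ie : 2 ^- i <= eps0 := le_trans (pow_le _ _ a) j0e.
  apply: s_mono; rewrite ?in_itv /= ?pow0 //=; last exact: pow_le.
  by apply: le_trans ie; exact: pow_le.
have s_small e : 0 < e -> exists j0, forall j, (j0 <= j)%N -> gj j / hj j <= e.
  move=> e0; have /cvgrPdist_lt/(_ e e0) := s_lim; rewrite near_withinE => -[t /= t0 H].
  have t2 : 0 < t / 2 by rewrite divr_gt0.
  have [j0 j0t] := pow2V_small t2; exists j0 => j jj.
  have : `|0 - g (2 ^- j) / h (2 ^- j)| < e.
    apply: H => //=; rewrite sub0r normrN gtr0_norm //.
    by apply: le_lt_trans (le_trans (pow_le _ _ jj) j0t) _; lra.
  by rewrite sub0r normrN gtr0_norm ?divr_gt0 ?gj0 ?hj0 // => /ltW.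
have [A HA] : exists A, forall j, gj j / hj j * psi j <= A.
  have [j0 sn] := s_noninc.
  have t0 j : 0 <= gj j / hj j * (psi j - psi j.-1).
    by rewrite mulr_ge0 ?subr_ge0 ?psin ?leq_pred // divr_ge0 // ltW.
  have [M HM] : exists M : R, (\sum_(1 <= j <oo) (gj j / hj j * (psi j - psi j.-1))%:E <= M%:E)%E.
    move: s_sum; rewrite -/gj.
    set S := (X in (X < +oo)%E) => Sfin; exists (fine S); rewrite fineK // ge0_fin_numE //.
    by apply: nneseries_ge0 => j _ _; rewrite lee_fin t0.
  apply: (bounded_of_increments (j0 := j0) (M := M)) => //.
  - by move=> j; rewrite divr_ge0 // ltW.
  - by move=> j; exact: ltW.
  - move=> n; rewrite -lee_fin -sumEFin; apply: le_trans HM.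
    by apply: nneseries_lim_ge => j _ _; rewrite lee_fin t0.
have gpsi j : gj j * psi j <= A * hj j.
  by have := HA j; rewrite mulrAC ler_pdivrMr.
have bs N0 M : exists N, M <= block_sum psi q lv N0 N.
  (* The two inputs are [r n <= 2 / q n], and [2 ^- lv n <= r n] together with monotonicity of
     [phi]. *)
  have term n : r n / phi (r n) <= 2 * ((q n)%:R^-1 * psi (lv n)).
    have /andP[r0 r1] := r01 n; have [_ /andP[qa qb]] := q_bounds n.
    have q0R : 0 < (q n)%:R :> R by rewrite ltr0n.
    have ir1 : 1 <= (r n)^-1 by rewrite invf_ge1.
    have rq : r n <= 2 / (q n)%:R.
      rewrite ler_pdivlMr // -ler_pdivlMl // mulrC; lra.
    have lvr : 2 ^- lv n <= r n.
      apply: (@le_trans _ _ (q n)%:R^-1).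
        by rewrite lef_pV2 ?posrE ?exprn_gt0 // -natrX ler_nat; case/andP: (q_lv n).
      by rewrite -[leRHS]invrK lef_pV2 ?posrE ?invr_gt0.
    rewrite mulrA ler_pM ?invr_ge0 ?(ltW r0) ?(ltW (ppos _ r0)) //.
    by rewrite lef_pV2 ?posrE ?ppos //; apply: mono lvr => //; exact: ltW.
  apply: (unbounded_tail (u := fun n => r n / phi (r n))
    (v := fun n => (q n)%:R^-1 * psi (lv n))) => // n.
    by have /andP[r0 _] := r01 n; rewrite divr_ge0 ?(ltW (ppos _ r0)) // ltW.
  by rewrite mulr_ge0 ?(ltW (psi0 _)) // invr_ge0.
have [c0 c00 GL] := net_content_gt0 gg GT gG.
(* This copy of [G] in the line contains 1 as well as 0 when 0 is in [G], so that it is compact for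
   the topology of the line. *)
pose K0 : set R := [set x | G (tfrac x)] `&` `[0, 1]%classic.
have K0c : compact K0.
  by apply: subclosed_compact (@segment_compact R 0 1) _; [apply: closedI => //; exact: interval_closed | exact: subIsetr].
have [c cpos goodK0] : exists2 c, 0 < c & good_set gj hj c K0.
  have [j0 sn] := s_noninc.
  (* [S] is at least 1 and bounds [g / h] at all dyadic scales, so the minimum of [h] and [g] is at
     least [g / S]; halving makes room for the strict inequality in [good_set]. *)
  pose S := 1 + \sum_(0 <= i < j0.+1) gj i / hj i.
  have s0 i : 0 <= gj i / hj i by rewrite divr_ge0 // ltW.
  have S1 : 1 <= S by rewrite lerDl sumr_ge0.
  have S0 : 0 < S by apply: lt_le_trans S1.
  have sS j : gj j / hj j <= S.
    have le i : (i <= j0)%N -> gj i / hj i <= S.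
      move=> ij; rewrite /S (bigD1_seq i) ?iota_uniq ?mem_index_iota ?ltnS //=.
      by rewrite addrCA lerDl addr_ge0 // sumr_ge0.
    have [/le //|j0j] := leqP j j0; apply: le_trans (le _ (leqnn j0)).
    by apply: sn; rewrite leqnn ltnW.
  exists (c0 / S / 2); first by rewrite !divr_gt0.
  exists 1, (c0 / S); split => //.
    by rewrite ltr_pdivrMr // ltr_pMr ?divr_gt0 // ltr1n.
  move=> L HL; rewrite ler_pdivrMr //; apply: le_trans (GL L _) _.
    move=> x Gx; have xT := GT _ Gx; apply: HL => //; split => /=; first by rewrite tfrac_id.
    by move: xT; rewrite /torus /= !in_itv /= => /andP[-> /ltW ->].
  rewrite mulr_suml; apply: ler_sum => p _; rewrite mul1r -/(gj p.1).
  have gS : gj p.1 <= hj p.1 * S by rewrite mulrC -ler_pdivrMr.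
  case: (leP (h (2 ^- p.1)) (gj p.1)) => _; first exact: gS.
  by rewrite ler_peMr // ltW // gj0.
pose C s := cantor_set q K0 s.
pose bad (sN : seq (seq (nat * nat)) * nat) := [set w | good_set gj hj c (C sN.1) /\
  forall N, ~ good_set gj hj c (C sN.1 `&` hit_set X r sN.2 N w)].
(* One null set for each pair of a list of blocks and a starting index; there are countably many
   such pairs. *)
have bad_negl : P.-negligible (\bigcup_n (if unpickle n is Some sN then bad sN else set0)).
  apply: negligible_bigcup => n; case: unpickle => [sN|]; last exact: negligible_set0.
  exact: (negligible_stage X_meas X_torus X_unif r01 Th _ _ gj0 hj0 psi0 hjn psin gpsi q_lv
    s_noninc s_small bs cpos).
apply: negligibleS bad_negl => w /= nw; apply: contrapT => nbad; apply: nw.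
have step s N0 : exists N, good_set gj hj c (C s) -> good_set gj hj c (C s `&` hit_set X r N0 N w).
  apply: contrapT => /forallNP none; apply: nbad; exists (pickle (s, N0)) => //.
  rewrite pickleK; split => /= [|N gd]; last by apply: (none N).
  by have /not_implyP[] := none 0%N.
have [kk Hkk] : {kk : nat -> nat & forall n, (kk n < q n)%N /\ Ik (q n) (kk n) (X n w)}.
  apply: (@choice _ _ (fun n k => (k < q n)%N /\ Ik (q n) k (X n w))) => n.
  by have [k kq Xk] := Ik_exists (q0 n) (X_torus n w); exists k.
pose blk N0 N := [seq (n, kk n) | n <- index_iota N0 N].
have [len Hlen] : {len : seq (seq (nat * nat)) * nat -> nat & forall sN,
    good_set gj hj c (C sN.1) -> good_set gj hj c (C (blk sN.2 (len sN) :: sN.1))}.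
  apply: (@choice _ _ (fun sN N => good_set gj hj c (C sN.1) ->
    good_set gj hj c (C (blk sN.2 N :: sN.1)))) => -[s N0] /=.
  have [N HN] := step s N0; exists N => /HN.
  apply: good_set_sub => x [[Cx [n nN [k xk Xk]]] _]; split => //.
  rewrite -bigcup_seq; exists (n, kk n); first by apply/mapP; exists n; rewrite ?mem_index_iota.
  have -> : kk n = k by apply: Ik_inj (q0 n) (Hkk n).2 Xk.
  by move: xk; rewrite /Ik /closed_cell /= in_itv /= => /andP[-> /ltW ->].
(* The block added at stage [u] starts at index [u], so points of the intersection lie in cells of
   arbitrarily large index. *)
pose sq := fix sq t := if t is u.+1 then blk u (len (sq u, u)) :: sq u else [::].
have sq_good t : good_set gj hj c (C (sq t)).
  by elim: t => [|t IH] //=; exact: (Hlen (sq t, t)).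
(* The exceptional points enumerate all fractions [k / q n], among them every right endpoint of a
   closed cell. *)
apply: (hausdorff_limit_gt0 hh (K := fun t => C (sq t)) (c := c)
  (dd := fun i => if unpickle i is Some nk then nk.2%:R / (q nk.1)%:R else 0)) => //.
- by move=> t; exact: cantor_set_compact.
- by move=> t x [].
- move=> t L HL; have [B [c' [B0 cc' H]]] := sq_good t.
  apply/ltW/(lt_le_trans cc')/(le_trans (H L HL)).
  by apply: ler_sum => p _; rewrite ge_min lexx.
move=> x xC.
have [dx|nd] := pselect (exists i,
  x = if unpickle i is Some nk then nk.2%:R / (q nk.1)%:R else 0); first by left.
right; have seg t : exists2 n, (t <= n)%N & Ik (q n) (kk n) x.
  have [_] := xC t.+1; rewrite -bigcup_seq => -[_ /mapP[n + ->]].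
  rewrite mem_index_iota /closed_cell /= in_itv /= => /andP[tn _] /andP[a b].
  exists n => //; rewrite /Ik /= a lt_neqAle b andbT /=; apply/eqP => xe.
  by apply: nd; exists (pickle (n, (kk n).+1)); rewrite pickleK.
have [n0 _ x0] := seg 0%N; have xT := Ik_torus (Hkk n0).1 x0.
split; last by have [] := xC 0%N; rewrite /= tfrac_id.
split => // N0; have [n nN xn] := seg N0; exists n => //.
apply: le_lt_trans (tdist_le _ _) _; apply: lt_le_trans (Ik_near xn (Hkk n).2) _.
have /andP[r0 _] := r01 n; have [_ /andP[qa _]] := q_bounds n.
by rewrite -[leRHS]invrK lef_pV2 ?posrE ?invr_gt0 // ltr0n.
Qed.
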